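(* Let $\epsilon>0$. There exists $P=P(\epsilon)$ such that for every prime $p\ge P$, every positive integer $d$, every integer $s>(2+\epsilon)d^2$ and all $a_1,\dots,a_s,b_1,\dots,b_s\in\mathbb{Q}_p$, the system \[ a_1x_1^d+\cdots+a_sx_s^d=0,\qquad b_1x_1^d+\cdots+b_sx_s^d=0 \] has a solution $(x_1,\dots,x_s)\in\mathbb{Q}_p^s\setminus\{\mathbf 0\}$. *)

(* Defs.v *)
From HB Require Import structures.
From mathcomp Require Import all_boot all_order all_algebra.
From mathcomp Require Import boolp reals.

Set Implicit Arguments.
Unset Strict Implicit.
Unset Printing Implicit Defensive.

Import GRing.Theory.

(* The ring Z_p, as the inverse limit of the Z/p^n: the class of x modulo p^n
   is represented by x n. The compatibility condition also forces x n < p^n. *)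
Record padic_int (p : nat) (p_pr : prime p) := PadicInt {
  padic_res :> nat -> nat;
  padic_resS : forall n, padic_res n.+1 %% p ^ n = padic_res n
}.

Section PadicInt.
Variables (p : nat) (p_pr : prime p).
Local Notation Zp := (padic_int p_pr).
Implicit Types x y z : Zp.

HB.instance Definition _ := gen_eqMixin Zp.
HB.instance Definition _ := gen_choiceMixin Zp.

Lemma padic_intP x y : x =1 y -> x = y.
Proof.
case: x y => [f fP] [g gP] /= /funext fg; move: fP gP; rewrite fg => fP gP.
by rewrite (Prop_irrelevance fP gP).
Qed.

Lemma modn_padic_res x m n : m <= n -> x n %% p ^ m = x m.
Proof.
elim: n => [|n IHn]; first by rewrite leqn0 => /eqP ->; rewrite -padic_resS modn_mod.
rewrite leq_eqVlt => /predU1P [->|]; first by rewrite -(padic_resS x n.+1) modn_mod.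
by rewrite ltnS => le_mn; rewrite -(modn_dvdm _ (dvdn_exp2l p le_mn)) padic_resS IHn.
Qed.

Lemma modn_padic_id x n : x n %% p ^ n = x n.
Proof. exact: modn_padic_res. Qed.

Fact padic_reduce_subproof (f : nat -> nat)
    (fP : forall n, f n.+1 = f n %[mod p ^ n]) n :
  (f n.+1 %% p ^ n.+1) %% p ^ n = f n %% p ^ n.
Proof. by rewrite modn_dvdm ?fP // dvdn_exp2l. Qed.

Definition padic_reduce f (fP : forall n, f n.+1 = f n %[mod p ^ n]) : Zp :=
  PadicInt p_pr (padic_reduce_subproof fP).

Fact padic_const_subproof k n : k = k %[mod p ^ n].
Proof. by []. Qed.

Fact padic_add_subproof x y n : x n.+1 + y n.+1 = x n + y n %[mod p ^ n].
Proof. by rewrite -modnDm !padic_resS. Qed.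

Fact padic_mul_subproof x y n : x n.+1 * y n.+1 = x n * y n %[mod p ^ n].
Proof. by rewrite -modnMm !padic_resS. Qed.

Lemma padic_res_lt x n : x n < p ^ n.
Proof. by rewrite -modn_padic_id ltn_pmod // expn_gt0 prime_gt0. Qed.

Fact padic_opp_subproof x n :
  p ^ n.+1 - x n.+1 = p ^ n - x n %[mod p ^ n].
Proof.
apply/eqP; rewrite -(eqn_modDr (x n.+1)) subnK; last exact/ltnW/padic_res_lt.
rewrite -[X in _ == X](modnDmr (p ^ n - x n)) padic_resS.
rewrite subnK; last exact/ltnW/padic_res_lt.
by rewrite expnS modnMl modnn.
Qed.

Definition padic_const k := padic_reduce (@padic_const_subproof k).
Definition padic_add x y := padic_reduce (padic_add_subproof x y).
Definition padic_mul x y := padic_reduce (padic_mul_subproof x y).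
Definition padic_opp x := padic_reduce (padic_opp_subproof x).

Fact padic_addA : associative padic_add.
Proof. by move=> x y z; apply: padic_intP => n /=; rewrite modnDml modnDmr addnA. Qed.

Fact padic_addC : commutative padic_add.
Proof. by move=> x y; apply: padic_intP => n /=; rewrite addnC. Qed.

Fact padic_add0 : left_id (padic_const 0) padic_add.
Proof. by move=> x; apply: padic_intP => n /=; rewrite mod0n modn_padic_id. Qed.

Fact padic_addN : left_inverse (padic_const 0) padic_opp padic_add.
Proof.
move=> x; apply: padic_intP => n /=.
by rewrite modnDml subnK ?modnn ?mod0n //; exact/ltnW/padic_res_lt.
Qed.

HB.instance Definition _ :=
  GRing.isZmodule.Build Zp padic_addA padic_addC padic_add0 padic_addN.

Fact padic_mulA : associative padic_mul.
Proof. by move=> x y z; apply: padic_intP => n /=; rewrite modnMml modnMmr mulnA. Qed.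

Fact padic_mulC : commutative padic_mul.
Proof. by move=> x y; apply: padic_intP => n /=; rewrite mulnC. Qed.

Fact padic_mul1 : left_id (padic_const 1) padic_mul.
Proof. by move=> x; apply: padic_intP => n /=; rewrite modnMml mul1n modn_padic_id. Qed.

Fact padic_mulDl : left_distributive padic_mul padic_add.
Proof.
by move=> x y z; apply: padic_intP => n /=; rewrite modnMml modnDm mulnDl.
Qed.

Fact padic_oner_neq0 : padic_const 1 != padic_const 0.
Proof.
apply/eqP => /(congr1 (fun x : Zp => x 1)) /=.
by rewrite expn1 mod0n modn_small // prime_gt1.
Qed.

HB.instance Definition _ := GRing.Zmodule_isComNzRing.Build Zp
  padic_mulA padic_mulC padic_mul1 padic_mulDl padic_oner_neq0.

Lemma padic_res0 n : (0%R : Zp) n = 0.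
Proof. exact: mod0n. Qed.

Lemma padic_res1 n : (1%R : Zp) n = 1 %% p ^ n.
Proof. by []. Qed.

Lemma padic_resD x y n : (x + y)%R n = (x n + y n) %% p ^ n.
Proof. by []. Qed.

Lemma padic_resM x y n : (x * y)%R n = (x n * y n) %% p ^ n.
Proof. by []. Qed.

Definition padic_unit : {pred Zp} := fun x => `[< exists y, (y * x = 1)%R >].

Definition padic_inv x : Zp :=
  if pselect (exists y, (y * x = 1)%R) is left e then projT1 (cid e) else x.

Fact padic_mulV : {in padic_unit, left_inverse 1%R padic_inv *%R}.
Proof.
move=> x /asboolP xU; rewrite /padic_inv.
by case: pselect => // e; case: (cid e).
Qed.

Fact padic_unitPl x y : (y * x = 1)%R -> padic_unit x.
Proof. by move=> yx1; apply/asboolP; exists y. Qed.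

Fact padic_inv_out : {in [predC padic_unit], padic_inv =1 id}.
Proof.
move=> x /asboolPn xU; rewrite /padic_inv.
by case: pselect => // e; case: xU.
Qed.

HB.instance Definition _ := GRing.ComNzRing_hasMulInverse.Build Zp
  padic_mulV padic_unitPl padic_inv_out.

Lemma padic_neq0 x : x != 0%R -> exists n, x n != 0.
Proof.
move=> x0; apply: contrapT => /forallNP xn0; case/eqP: x0.
apply: padic_intP => n; rewrite padic_res0; apply/eqP.
by apply: contrapT => /negP; exact: xn0.
Qed.

Fact padic_integral : GRing.integral_domain_axiom Zp.
Proof.
move=> x y xy0; apply/norP => -[/padic_neq0 [m xm0] /padic_neq0 [n yn0]].
have val_lt (z : Zp) k l : k <= l -> z k != 0 -> 0 < z l /\ logn p (z l) < k.
  move=> le_kl; rewrite -(modn_padic_res z le_kl) => zk0.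
  have zl_gt0 : 0 < z l by rewrite lt0n; apply: contraNneq zk0 => ->; rewrite mod0n.
  by split=> //; rewrite ltnNge -pfactor_dvdn.
have [xl_gt0 xl_lt] := val_lt x _ _ (leq_addr n m) xm0.
have [yl_gt0 yl_lt] := val_lt y _ _ (leq_addl m n) yn0.
have /eqP : (x * y)%R (m + n) = 0 by rewrite xy0 padic_res0.
rewrite padic_resM -/(dvdn _ _) pfactor_dvdn ?muln_gt0 ?xl_gt0 // lognM //.
by rewrite leqNgt -addSn leq_add // ltnW.
Qed.

HB.instance Definition _ := GRing.ComUnitRing_isIntegral.Build Zp padic_integral.

End PadicInt.

(* The field Q_p, as the fraction field of Z_p. *)
Notation padic p_pr := {fraction (padic_int p_pr)}.

(* Main.v *)
(* Rescaling variables and taking linear combinations of the two forms, one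
   reduces to integral coefficient vectors c_i = (a_i, b_i) for which the
   product of the determinants det (c_i, c_(s i)), for a permutation s such
   that all of them are nonzero, has minimal valuation.  Minimality forces at
   least s/d of the vectors to be primitive, and at least s/(2d) of them to be
   off any given line modulo p.  With d = d0 p^tau, a solution modulo
   p^(tau+1) whose support spans F_p^2 then lifts to Q_p.

   Such solutions are found in the group algebra of (Z/p^(tau+1))^2 over F_p,
   written with u = [(1,0)] - 1 and v = [(0,1)] - 1.  Summing [x^d c] over
   0 <= x < p gives an element of order E = (p-1)/gcd(d,p-1) in (u,v), so a
   product of more than 2(p^(tau+1)-1)/E of them vanishes: there are nontrivial
   solutions.  To leave a given line X, suppose that every solution lives on X.
   The variables off X define a function of low degree on the values taken by
   the variables on X, equal to 1 at 0 and to 0 elsewhere; cutting it down to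
   the bottom subgroup p^tau of the line and multiplying by the coordinate
   yields a function with known leading monomial u^alpha v^beta that vanishes
   on all values of the X-variables.  But those values span an element with
   leading form divisible by v^beta and with u^alpha in the cofactor: pairs of
   variables with distinct slopes produce powers of v, and the others powers
   of u.  If too few pairs with distinct slopes exist, almost all of X lies on
   a line modulo a higher power of p, and one starts again there. *)
Require Import Defs.
From HB Require Import structures.
From mathcomp Require Import all_boot all_order all_fingroup all_algebra all_solvable all_field.
From mathcomp Require Import boolp reals.
From mathcomp Require Import ring zify lra.

Set Implicit Arguments.
Unset Strict Implicit.
Unset Printing Implicit Defensive.

Import Order.TTheory GRing.Theory Num.Theory.
Local Open Scope ring_scope.

(** * Power sums over F_p *)

Lemma coef_1pX (R : comNzRingType) n j : ((1 + 'X : {poly R}) ^+ n)`_j = 'C(n, j)%:R.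
Proof.
rewrite exprDn coef_sum; have [jn|nj] := ltnP j n.+1.
  rewrite (bigD1 (Ordinal jn)) //= expr1n mul1r coefMn coefXn eqxx big1 ?addr0 //.
  move=> i; rewrite -val_eqE /= => ij.
  by rewrite expr1n mul1r coefMn coefXn eq_sym (negbTE ij) mul0rn.
rewrite bin_small // big1 // => i _.
by rewrite expr1n mul1r coefMn coefXn gtn_eqF ?mul0rn // (leq_trans (ltn_ord i)).
Qed.

Section PowerSums.
Variables (p : nat) (p_pr : prime p).
Local Notation F := 'F_p.

Lemma expf_predp (x : F) : x != 0 -> x ^+ p.-1 = 1.
Proof.
move=> x0; apply: (mulfI x0); rewrite mulr1 -exprS prednK ?prime_gt0 //.
by have := expf_card x; rewrite [#|_|]card_Fp.
Qed.

Lemma sum_exp_Fp_dvd m : (0 < m)%N -> (p.-1 %| m)%N ->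
  \sum_(x : F) x ^+ m = -1.
Proof.
move=> m0 /dvdnP[k mE]; rewrite (bigD1 0) //= expr0n eqn0Ngt m0 add0r.
rewrite (eq_bigr (fun _ => 1)); last first.
  by move=> x x0; rewrite mE mulnC exprM expf_predp ?expr1n.
rewrite sumr_const cardC1 card_Fp // -subn1 natrB ?prime_gt0 //.
by rewrite pchar_Fp_0 // sub0r.
Qed.

(** Scaling the variable by a nonzero [a] multiplies the sum by [a ^+ m]. Some [a] has
    [a ^+ m != 1], because ['X^r - 1] has at most [r < p.-1] roots. *)
Lemma sum_exp_Fp_ndvd m : ~~ (p.-1 %| m)%N -> \sum_(x : F) x ^+ m = 0.
Proof.
move=> pm; have p1 : (0 < p.-1)%N by rewrite -subn1 subn_gt0 prime_gt1.
set r := (m %% p.-1)%N.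
have r0 : (0 < r)%N by rewrite lt0n.
have [a [a0 ar]] : exists a : F, a != 0 /\ a ^+ r != 1.
  case: (pickP [pred a : F | (a != 0) && (a ^+ r != 1)]) => [a /andP[]|no].
    by exists a.
  have : (size (enum (predC1 (0%R : F))) < size ('X^r - 1%:P : {poly F})%R)%N.
    apply: max_poly_roots; rewrite ?enum_uniq //.
      by rewrite -size_poly_eq0 size_XnsubC.
    apply/allP => a; rewrite mem_enum => /= a0.
    have := no a; rewrite /= -topredE /= in a0 *; rewrite a0 /= => /negbFE/eqP ar.
    by rewrite rootE !hornerE ar subrr.
  rewrite size_XnsubC // -cardE cardC1 card_Fp // ltnS leqNgt.
  by rewrite ltn_pmod.
have am : a ^+ m != 1.
  by rewrite (divn_eq m p.-1) exprD mulnC exprM expf_predp // expr1n mul1r.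
apply/eqP; have : (a ^+ m - 1) * (\sum_(x : F) x ^+ m) = 0.
  rewrite mulrBl mul1r big_distrr /=.
  rewrite [X in _ - X](reindex_inj (mulfI a0)) /=.
  by rewrite -sumrB big1 // => x _; rewrite exprMn subrr.
by move/eqP; rewrite mulf_eq0 subr_eq0 (negbTE am).
Qed.

(** For [j < p] the number j! is invertible modulo p, which makes the binomial coefficient a
    polynomial of exact degree [j] over F_p. *)
Lemma binomial_polyF (j : nat) : (j < p)%N -> exists2 P : {poly F},
  (size P = j.+1) & forall h : nat, 'C(h, j)%:R = P.[h%:R].
Proof.
elim: j => [|j IHj] jp.
  by exists 1; [rewrite size_poly1 | move=> h; rewrite bin0 hornerC].
have [P sP PE] := IHj (ltnW jp).
have j0 : j.+1%:R != 0 :> F.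
  by rewrite -(dvdn_pcharf (pchar_Fp p_pr)) gtnNdvd.
have P0 : P != 0 by rewrite -size_poly_eq0 sP.
exists (j.+1%:R^-1 *: (('X - j%:R%:P) * P)).
  rewrite size_scale ?invr_eq0 // size_monicM ?monicXsubC // size_XsubC sP.
  by rewrite addnC addn2.
move=> h; rewrite !hornerE -PE; apply: (mulfI j0); rewrite /= -mulrA mulVKf //.
rewrite -natrM mul_bin_left natrM.
have [jh|hj] := leqP j h; first by rewrite natrB.
by rewrite bin_small // mulr0n !mulr0.
Qed.

(* The weights [x ^+ (d * (E - e))] select the coefficient of order [e]: a
   power sum over F_p vanishes unless its exponent is a nonzero multiple of
   [p.-1], and [p.-1] divides [d * t] exactly when [E] divides [t]. *)
Variables (d : nat) (d_gt0 : (0 < d)%N).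
(** The order of the group of nonzero d-th powers in F_p. *)
Definition powder := (p.-1 %/ gcdn d p.-1)%N.
Local Notation E := powder.

Lemma powder_gt0 : (0 < E)%N.
Proof.
have p1 : (0 < p.-1)%N by rewrite -subn1 subn_gt0 prime_gt1.
by rewrite divn_gt0 ?gcdn_gt0 ?d_gt0 // dvdn_leq // dvdn_gcdr.
Qed.

Lemma powder_lt : (E < p)%N.
Proof. by rewrite -[p in X in (_ < X)%N]prednK ?prime_gt0 // ltnS leq_div. Qed.

Lemma dvdn_powder t : (p.-1 %| d * t)%N = (E %| t)%N.
Proof.
have g0 : (0 < gcdn d p.-1)%N by rewrite gcdn_gt0 d_gt0.
have pE : p.-1 = (E * gcdn d p.-1)%N by rewrite divnK // dvdn_gcdr.
have dE : d = (d %/ gcdn d p.-1 * gcdn d p.-1)%N by rewrite divnK // dvdn_gcdl.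
rewrite [X in (X %| _)%N]pE [X in (_ %| X * _)%N]dE mulnAC dvdn_pmul2r // Gauss_dvdr // coprime_sym.
rewrite /coprime -(eqn_pmul2r g0) mul1n muln_gcdl -pE -dE; exact/eqP.
Qed.

Definition rho (e : nat) : {poly F} :=
  \sum_(x : F) x ^+ (d * (E - e)) *: (1 + 'X) ^+ (x ^ d).

Lemma coef_rho e j : (e <= E)%N -> (j <= e)%N ->
  exists2 c : F, c != 0 & (rho e)`_j = - c *+ (j == e).
Proof.
move=> eE je; have jE := leq_trans je eE.
have [P sP PE] := binomial_polyF (leq_ltn_trans jE powder_lt).
exists (lead_coef P); first by rewrite lead_coef_eq0 -size_poly_eq0 sP.
(* Writing the binomial coefficient as a polynomial in x^d gives a combination of power sums. Among
   [l <= e], only [l = e] makes [E - e + l] a nonzero multiple of [E]. *)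
have -> : (rho e)`_j = \sum_(l < j.+1) P`_l * \sum_(x : F) x ^+ (d * (E - e + l)).
  rewrite coef_sum (eq_bigr (fun x : F =>
    \sum_(l < j.+1) P`_l * x ^+ (d * (E - e + l)))); last first.
    move=> x _; rewrite coefZ coef_1pX PE natrX natr_Zp horner_coef sP big_distrr /=.
    by apply: eq_bigr => l _; rewrite mulrCA -exprM -exprD mulnDr.
  by rewrite exchange_big /=; apply: eq_bigr => l _; rewrite big_distrr.
have S0 l : (l < e)%N -> \sum_(x : F) x ^+ (d * (E - e + l)) = 0.
  move=> le; have [->|t0] := posnP (E - e + l)%N.
    rewrite muln0 (eq_bigr (fun _ => 1)) // sumr_const card_Fp //.
    by rewrite pchar_Fp_0.
  apply: sum_exp_Fp_ndvd; rewrite dvdn_powder gtnNdvd //.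
  by rewrite -ltn_subRL subKn.
rewrite big_ord_recr /= big1 ?add0r; last first.
  by move=> l _; rewrite S0 ?mulr0 // (leq_trans (ltn_ord l)).
rewrite lead_coefE sP /=; move: je; rewrite leq_eqVlt => /predU1P[->|je].
  rewrite eqxx subnK // sum_exp_Fp_dvd ?mulrN1 //.
    by rewrite muln_gt0 d_gt0 powder_gt0.
  by rewrite dvdn_powder.
by rewrite S0 // mulr0 ltn_eqF.
Qed.

End PowerSums.

(** * The group algebra and its filtration *)

Section Filtration.
Variable F : fieldType.
Local Notation A := {poly {poly F}}.
Implicit Types (P Q : A) (c : F).

(* Elements of the n-th power of the ideal (u, v), where u is the inner and v
   the outer variable of [A]. *)
Definition ord (n : nat) P := forall i j, (i + j < n)%N -> P`_j`_i = 0.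

Lemma ord_le m n P : (m <= n)%N -> ord n P -> ord m P.
Proof. by move=> mn oP i j ij; apply: oP; apply: leq_trans mn. Qed.

Lemma ord0 P : ord 0 P. Proof. by []. Qed.

Lemma ordD n P Q : ord n P -> ord n Q -> ord n (P + Q).
Proof. by move=> oP oQ i j ij; rewrite !coefD oP // oQ // addr0. Qed.

Lemma coef2M P Q i j : (P * Q)`_j`_i =
  \sum_(l < j.+1) \sum_(k < i.+1) P`_l`_k * Q`_(j - l)`_(i - k).
Proof. by rewrite coefM coef_sum; apply: eq_bigr => l _; rewrite coefM. Qed.

Lemma ordM m n P Q : ord m P -> ord n Q -> ord (m + n) (P * Q).
Proof.
move=> oP oQ i j ij; rewrite coef2M big1 // => l _; rewrite big1 // => k _.
have [kl|kl] := ltnP (k + l) m; first by rewrite oP ?mul0r.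
rewrite oQ ?mulr0 // -(ltn_add2l (k + l)); apply: leq_trans (leq_add kl (leqnn n)).
rewrite addnACA !subnKC ?leq_ord //.
Qed.

Lemma ordMl n P Q : ord n P -> ord n (P * Q).
Proof. by move=> oP; rewrite -[n]addn0; apply: ordM. Qed.

Lemma ordMr n P Q : ord n Q -> ord n (P * Q).
Proof. by rewrite mulrC; apply: ordMl. Qed.

Lemma ordX m n P : ord m P -> ord (m * n) (P ^+ n).
Proof.
move=> oP; elim: n => [|n IHn]; first by rewrite muln0.
by rewrite exprS mulnS; apply: ordM.
Qed.

Lemma ord_sum n (I : Type) (r : seq I) (T : pred I) (G : I -> A) :
  (forall i, T i -> ord n (G i)) -> ord n (\sum_(i <- r | T i) G i).
Proof. by move=> oG; elim/big_ind: _ => //; [move=> i j _; rewrite !coef0|exact: ordD]. Qed.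

Lemma ordM_congr m n P P' Q Q' : ord m P -> ord n Q' ->
  ord m.+1 (P' - P) -> ord n.+1 (Q' - Q) -> ord (m + n).+1 (P' * Q' - P * Q).
Proof.
move=> oP oQ oP' oQ'.
have -> : P' * Q' - P * Q = (P' - P) * Q' + P * (Q' - Q) by rewrite mulrBl mulrBr addrA subrK.
by apply: ordD; [rewrite -addSn; apply: ordM | rewrite -addnS; apply: ordM].
Qed.

Definition scal c : A := c%:P%:P.

Lemma scal0 : scal 0 = 0. Proof. by rewrite /scal !polyC0. Qed.
Lemma scal1 : scal 1 = 1. Proof. by rewrite /scal !polyC1. Qed.
Lemma scalB c c' : scal (c - c') = scal c - scal c'.
Proof. by rewrite /scal !polyCB. Qed.
Lemma scalM c c' : scal (c * c') = scal c * scal c'.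
Proof. by rewrite /scal !polyCM. Qed.
Lemma scalX c n : scal (c ^+ n) = scal c ^+ n.
Proof. by rewrite /scal !polyC_exp. Qed.
Lemma scalMn c n : scal (c *+ n) = scal c *+ n.
Proof. by rewrite /scal !polyCMn. Qed.

(** The group element [(z,w)], with u = [(1,0)] - 1 and v = [(0,1)] - 1. The relations (1+u)^q =
    (1+v)^q = 1 are not imposed on [A]; periodicity enters only through the functionals applied to
    it. *)
Definition mon (z w : nat) : A := ((1 + 'X) ^+ z)%:P * (1 + 'X) ^+ w.

Lemma mon00 : mon 0 0 = 1. Proof. by rewrite /mon !expr0 mulr1. Qed.

Lemma monD z w z' w' : mon (z + z') (w + w') = mon z w * mon z' w'.
Proof. by rewrite /mon !exprD polyCM mulrACA. Qed.

Lemma monX z w h : mon (z * h) (w * h) = mon z w ^+ h.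
Proof. by rewrite /mon !exprM exprMn -polyC_exp. Qed.

Lemma mon_sum (I : Type) (r : seq I) (T : pred I) (f g : I -> nat) :
  mon (\sum_(i <- r | T i) f i) (\sum_(i <- r | T i) g i) =
  \prod_(i <- r | T i) mon (f i) (g i).
Proof.
elim: r => [|i r IHr]; first by rewrite !big_nil mon00.
by rewrite !big_cons; case: ifP => // _; rewrite monD IHr.
Qed.

Lemma mon_lift z w : mon z w = ((1 + 'X) ^+ z)%:P * ((1 + 'X) ^+ w)^:P.
Proof. by congr (_ * _); rewrite rmorphXn rmorphD rmorph1 /= map_polyX. Qed.

Definition pair1 (phi : nat -> F) (f : {poly F}) := \sum_(i < size f) f`_i * phi i.

Lemma pair1E n phi (f : {poly F}) : (size f <= n)%N ->
  pair1 phi f = \sum_(i < n) f`_i * phi i.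
Proof.
move=> sf; rewrite /pair1 (big_ord_widen n (fun i => f`_i * phi i)) //.
rewrite big_mkcond; apply: eq_bigr => i _; case: ifP => // /negbT.
by rewrite -leqNgt => fi; rewrite nth_default // mul0r.
Qed.

Fact pair1_is_scalar phi : scalar (pair1 phi).
Proof.
move=> c f g; pose n := maxn (size (c *: f + g)) (maxn (size f) (size g)).
rewrite !(@pair1E n) /n; try by rewrite ?leq_max ?leqnn ?orbT.
rewrite big_distrr -big_split /=; apply: eq_bigr => i _.
by rewrite coefD coefZ mulrDl mulrA.
Qed.

HB.instance Definition _ phi :=
  GRing.isLinear.Build F {poly F} F _ (pair1 phi) (pair1_is_scalar phi).

Lemma pair1_Xn phi n : pair1 phi 'X^n = phi n.
Proof.
rewrite (@pair1E n.+1) ?size_polyXn // big_ord_recr /= coefXn eqxx mul1r big1 ?add0r //.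
by move=> i _; rewrite coefXn ltn_eqF // mul0r.
Qed.

Definition pair2 (phi psi : nat -> F) P := pair1 psi (map_poly (pair1 phi) P).

Lemma pair2E n phi psi P : (size P <= n)%N ->
  pair2 phi psi P = \sum_(j < n) pair1 phi P`_j * psi j.
Proof.
move=> sP; rewrite /pair2 (@pair1E n); last exact: leq_trans (size_poly _ _) _.
by apply: eq_bigr => j _; rewrite coef_map.
Qed.

(** Linearity over [F], stated by hand because the canonical module structure of [A] has scalars in
    [{poly F}]. *)
Definition functional (L : A -> F) := forall c P Q, L (scal c * P + Q) = c * L P + L Q.

Lemma pair2_functional phi psi : functional (pair2 phi psi).
Proof.
move=> c P Q; pose n := maxn (size (scal c * P + Q)) (maxn (size P) (size Q)).
rewrite !(@pair2E n) /n; try by rewrite ?leq_max ?leqnn ?orbT.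
rewrite big_distrr -big_split /=; apply: eq_bigr => i _.
by rewrite coefD coefCM mul_polyC linearP /= mulrDl mulrA.
Qed.

Lemma functional0 L : functional L -> L 0 = 0.
Proof.
move=> lL; have := lL (-1) 0 0; rewrite mulr0 addr0 mulN1r addNr; exact: id.
Qed.

Lemma functionalD L P Q : functional L -> L (P + Q) = L P + L Q.
Proof. by move=> lL; have := lL 1 P Q; rewrite /scal !mul1r. Qed.

Lemma functionalZ L c P : functional L -> L (scal c * P) = c * L P.
Proof. by move=> lL; have := lL c P 0; rewrite functional0 // !addr0. Qed.

Lemma functional_sum L (I : Type) (r : seq I) (T : pred I) (G : I -> A) : functional L ->
  L (\sum_(i <- r | T i) G i) = \sum_(i <- r | T i) L (G i).
Proof.
move=> lL; elim: r => [|i r IHr]; first by rewrite !big_nil functional0.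
by rewrite !big_cons; case: ifP => // _; rewrite functionalD // IHr.
Qed.

Lemma functional_mulr L Q : functional L -> functional (fun P => L (P * Q)).
Proof. by move=> lL c P P'; rewrite mulrDl -mulrA lL. Qed.

Lemma pair2_mon phi psi z w : pair2 phi psi (mon z w) =
  pair1 phi ((1 + 'X) ^+ z) * pair1 psi ((1 + 'X) ^+ w).
Proof.
set f := _ ^+ z; set g := (1 + 'X) ^+ w; rewrite mon_lift -/f -/g.
have s : (size (f%:P * g^:P)%R <= size g)%N.
  apply/leq_sizeP => j gj; rewrite coefCM coef_map nth_default // mulr0 //.
rewrite (pair2E _ _ s) [pair1 psi g]/pair1 big_distrr /=; apply: eq_bigr => j _.
by rewrite coefCM coef_map [f * _]mulrC mul_polyC linearZ /= -mulrA mulrCA.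
Qed.

(** A monomial u^i v^j with [i <= al], [j <= be] and [i + j >= al + be] must be u^al v^be, so this
    is the only coefficient that is seen. *)
Lemma pair2_top phi psi al be P :
  (forall i, (al < i)%N -> phi i = 0) -> (forall j, (be < j)%N -> psi j = 0) ->
  ord (al + be) P -> pair2 phi psi P = P`_be`_al * phi al * psi be.
Proof.
move=> phi0 psi0 oP; pose n := maxn (size P) be.+1.
have bn : (be < n)%N by rewrite leq_max leqnn orbT.
rewrite (@pair2E n) ?leq_max ?leqnn // (bigD1 (Ordinal bn)) //= big1 ?addr0.
  congr (_ * _); pose m := maxn (size P`_be) al.+1.
  have am : (al < m)%N by rewrite leq_max leqnn orbT.
  rewrite (@pair1E m) ?leq_max ?leqnn // (bigD1 (Ordinal am)) //= big1 ?addr0 //.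
  move=> i; rewrite -val_eqE /= => ial; have [ila|ali] := ltnP i al.
    by rewrite oP ?mul0r // ltn_add2r.
  by rewrite phi0 ?mulr0 // ltn_neqAle eq_sym ial.
move=> j; rewrite -val_eqE /= => jbe; have [jlb|bj] := ltnP j be; last first.
  by rewrite psi0 ?mulr0 // ltn_neqAle eq_sym jbe.
rewrite /pair1 big1 ?mul0r // => i _; have [ial|ali] := leqP i al.
  by rewrite oP ?mul0r // -addnS leq_add.
by rewrite phi0 // mulr0.
Qed.

Lemma pair2_ord0 phi psi al be P :
  (forall i, (al <= i)%N -> phi i = 0) -> (forall j, (be <= j)%N -> psi j = 0) ->
  ord (al + be).-1 P -> pair2 phi psi P = 0.
Proof.
move=> phi0 psi0 oP; rewrite /pair2 {1}/pair1 big1 // => j _; rewrite coef_map_id0 ?linear0 //.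
have [bj|jb] := leqP be j; first by rewrite psi0 // mulr0.
rewrite /pair1 big1 ?mul0r // => i _; have [ai|ia] := leqP al i.
  by rewrite phi0 // mulr0.
rewrite oP ?mul0r //; move: ia jb; case: al {phi0 oP} => // al; case: be {psi0} => // be.
by rewrite addSn /= addnS !ltnS => ia jb; apply: leq_add.
Qed.

End Filtration.

(** * Leading forms of spanned elements *)

Section LeadingForms.
Variable F : fieldType.
Local Notation A := {poly {poly F}}.

Lemma coef_mon z w i j : (mon F z w)`_j`_i = 'C(z, i)%:R * 'C(w, j)%:R.
Proof. by rewrite coefCM coef_1pX [(1 + 'X) ^+ z * _]mulr_natr coefMn coef_1pX [RHS]mulr_natr. Qed.

Lemma ord_mon_sub1 z w : ord 1 (mon F z w - 1).
Proof.
move=> i j; rewrite ltnS leqn0 addn_eq0 => /andP[/eqP-> /eqP->].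
by rewrite !coefB coef_mon !bin0 mulr1 !coef1 /= subrr.
Qed.

Definition linform (a b : nat) : A := scal a%:R * 'X%:P + scal b%:R * 'X.

Lemma ord_linform a b : ord 1 (linform a b).
Proof.
move=> i j; rewrite ltnS leqn0 addn_eq0 => /andP[/eqP-> /eqP->].
rewrite !coefD !coefCM !coefC !coefX /=.
by rewrite coef0 !mulr0 addr0.
Qed.

(** The n-th power of the identity a' (a u + b v) - a (a' u + b' v) = (b a' - b' a) v, which
    eliminates u. *)
Lemma linform_elim a b a' b' n :
  scal ((b%:R * a'%:R - b'%:R * a%:R) ^+ n) * 'X^n =
  \sum_(e < n.+1) scal ((a'%:R ^+ (n - e) * (- a%:R) ^+ e) *+ 'C(n, e)) *
    (linform a b ^+ (n - e) * linform a' b' ^+ e).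
Proof.
have -> : scal ((b%:R * a'%:R - b'%:R * a%:R) ^+ n) * 'X^n =
   (scal a'%:R * linform a b + scal (- a%:R) * linform a' b') ^+ n.
  rewrite scalX -exprMn; congr (_ ^+ _).
  rewrite /linform scalB !scalM -[- a%:R]sub0r scalB scal0.
  by move: (scal a%:R) (scal a'%:R) (scal b%:R) (scal b'%:R) => x y z t; ring.
rewrite exprDn; apply: eq_bigr => e _.
rewrite !exprMn [scal (_ *+ 'C(_, _))]scalMn scalM !scalX.
move: (scal _) (scal _) (linform _ _) (linform _ _) => x y z t.
by rewrite mulrnAl mulrACA.
Qed.

Lemma ord_mon_linform z w : ord 2 (mon F z w - 1 - linform z w).
Proof.
move=> i j ij; rewrite !coefB coef_mon !coefD !coefCM !coefC !coefX.
case: j i ij => [|[|j]] [|[|i]] //= _; rewrite ?bin0 ?bin1 ?coefX ?coef1 ?coef0 /=;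
  by rewrite ?(mulr0, mul0r, mulr1, mul1r, subr0, addr0, add0r, subrr, oppr0).
Qed.

Lemma coefM_lead (f g : {poly F}) m n :
  (forall i, (i < m)%N -> f`_i = 0) -> (forall i, (i < n)%N -> g`_i = 0) ->
  (f * g)`_(m + n) = f`_m * g`_n.
Proof.
move=> f0 g0; have mn : (m < (m + n).+1)%N by rewrite ltnS leq_addr.
rewrite coefM (bigD1 (Ordinal mn)) //= addKn big1 ?addr0 // => i.
rewrite -val_eqE /= => im; have [lt_im|mi] := ltnP i m; first by rewrite f0 ?mul0r.
rewrite g0 ?mulr0 // ltn_subLR; last by rewrite -ltnS.
rewrite ltn_add2r.
by rewrite ltn_neqAle eq_sym im.
Qed.

Lemma coef_top_mul (r1 r2 : A) k al be : ord be.+1 (r1 - scal k * 'X^be) ->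
  ord al r2 -> (r1 * r2)`_be`_al = k * r2`_0`_al.
Proof.
move=> o1 o2; have := ordM o1 o2 (i := al) (j := be).
rewrite addSn addnC ltnS leqnn mulrBl !coefB => /(_ isT)/eqP; rewrite subr_eq0 => /eqP->.
by rewrite -mulrA coefCM coefCM coefXnM ltnn subnn.
Qed.

Lemma ord_scal_Xn k be : ord be (scal k * 'X^be : A).
Proof.
move=> i j ij; rewrite coefCM coefCM coefXn ltn_eqF ?coef0 ?mulr0 //.
by apply: leq_ltn_trans ij; apply: leq_addl.
Qed.

End LeadingForms.

(** * Elements spanned by the values of one variable, of a pair, and of many variables *)

Section Gadgets.
Variables (p : nat) (p_pr : prime p) (d : nat) (d_gt0 : (0 < d)%N).
Local Notation F := 'F_p.
Local Notation A := {poly {poly F}}.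
Local Notation E := (powder p d).

Definition emb (r : {poly F}) (w : A) : A := (map_poly (polyC \o polyC) r).[w].

Lemma emb_coef r w : emb r w = \sum_(j < size r) scal r`_j * w ^+ j.
Proof.
rewrite /emb (@horner_coef_wide _ (size r)) ?size_poly //.
by apply: eq_bigr => j _; rewrite coef_map.
Qed.

Lemma emb_rho e w :
  emb (rho p d e) w = \sum_(x : F) scal (x ^+ (d * (E - e))) * (1 + w) ^+ (x ^ d).
Proof.
have m1X n : map_poly (polyC \o polyC) ((1 + 'X) ^+ n : {poly F}) = (1 + 'X) ^+ n :> {poly A}.
  by rewrite rmorphXn /=; congr (_ ^+ _); rewrite rmorphD rmorph1 /= map_polyX.
rewrite /emb /rho rmorph_sum /= horner_sum; apply: eq_bigr => x _.
by rewrite -mul_polyC rmorphM /= map_polyC /= m1X hornerM hornerC horner_exp hornerD hornerX hornerC.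
Qed.

Lemma ord_emb (r : {poly F}) (w : A) e :
  (forall j, (j < e)%N -> r`_j = 0) -> ord 1 w ->
  ord e (emb r w) /\ ord e.+1 (emb r w - scal r`_e * w ^+ e).
Proof.
move=> r0 ow; have oX j : ord j (w ^+ j) by rewrite -[j in ord j]mul1n; apply: ordX.
rewrite emb_coef; split.
  apply: ord_sum => j _; have [je|ej] := ltnP j e.
    by rewrite r0 // scal0 mul0r => ? ? _; rewrite !coef0.
  by apply: ord_le ej _; apply: ordMr.
rewrite (_ : _ - _ = \sum_(j < size r | j != e :> nat) scal r`_j * w ^+ j).
  apply: ord_sum => j je; have [lt_je|ej] := ltnP j e.
    by rewrite r0 // scal0 mul0r => ? ? _; rewrite !coef0.
  by apply: (@ord_le _ _ j); [rewrite ltn_neqAle eq_sym je | apply: ordMr].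
have [er|re] := ltnP e (size r); last first.
  rewrite nth_default // scal0 mul0r subr0; apply: eq_bigl => j.
  by rewrite neq_ltn (leq_trans (ltn_ord j)).
by rewrite (bigD1 (Ordinal er)) //= addrAC subrr add0r.
Qed.

Variables (I : finType) (a b : I -> nat).

Definition powsum (c : I -> nat) (S : {set I}) (x : I -> F) := (\sum_(i in S) c i * x i ^ d)%N.

Lemma powsumU c (S S' : {set I}) x : [disjoint S & S'] ->
  powsum c (S :|: S') x = (powsum c S x + powsum c S' x)%N.
Proof. by move=> dS; rewrite /powsum -bigU //; apply: eq_bigl => i; rewrite !inE. Qed.

Lemma powsum_extend c x (S S' : {set I}) : S \subset S' ->
  powsum c S' (fun i => if i \in S then x i else 0) = powsum c S x.
Proof.
move=> /subsetP SS; rewrite /powsum (big_setID S) /= [X in (_ + X)%N]big1 ?addn0; last first.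
  by move=> i; rewrite inE => /andP[/negbTE-> _]; rewrite exp0n ?muln0.
apply: eq_big => [i|i]; last by rewrite inE => /andP[_ ->].
by rewrite inE; apply: andb_idl => /SS.
Qed.

(* [spanned S P] says that [P] lies in the span of the monomials attached to
   the values of the two diagonal forms restricted to the variables in [S]. *)
Definition spanned (S : {set I}) (P : A) := forall L, functional L ->
  (forall x : I -> F, L (mon F (powsum a S x) (powsum b S x)) = 0) -> L P = 0.

Lemma spanned1 : spanned set0 1.
Proof. by move=> L lL /(_ (fun=> 0)); rewrite /powsum !big_set0 mon00. Qed.

Lemma spanned_lin S c P Q : spanned S P -> spanned S Q -> spanned S (scal c * P + Q).
Proof. by move=> sP sQ L lL L0; rewrite lL sP // sQ // mulr0 addr0. Qed.

Lemma spanned_sum S (J : Type) (r : seq J) (T : pred J) (G : J -> A) (c : J -> F) :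
  (forall j, T j -> spanned S (G j)) -> spanned S (\sum_(j <- r | T j) scal (c j) * G j).
Proof.
move=> sG; elim/big_rec: _ => [L lL _|j P Tj sP]; first by rewrite functional0.
by apply: spanned_lin => //; apply: sG.
Qed.

Lemma spannedM (S S' : {set I}) P Q : [disjoint S & S'] -> spanned S P -> spanned S' Q ->
  spanned (S :|: S') (P * Q).
Proof.
move=> dSS sP sQ L lL L0; apply: (sP (fun P => L (P * Q))); first exact: functional_mulr.
move=> x; rewrite mulrC; apply: (sQ (fun Q => L (Q * _))); first exact: functional_mulr.
move=> y; rewrite mulrC -monD; pose z i := if i \in S then x i else y i.
rewrite -(L0 z) !powsumU //.
by congr (L (mon _ (_ + _) (_ + _))); apply: eq_bigr => i iS;
  rewrite /z ?iS // (disjointFl dSS).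
Qed.

(** By [emb_rho] this is a combination of the monomials at the values of the variable [i] alone. For
    [e <= E] its leading form is a nonzero constant times (a_i u + b_i v)^e. *)
Definition single i e := emb (rho p d e) (mon F (a i) (b i) - 1).

Lemma spanned_single i e : spanned [set i] (single i e).
Proof.
move=> L lL L0; rewrite /single emb_rho functional_sum // big1 // => x _.
rewrite functionalZ // addrCA subrr addr0 -monX.
by have := L0 (fun=> x); rewrite /powsum !big_set1 => ->; rewrite mulr0.
Qed.

Lemma rho_lead_neq0 e : (e <= E)%N -> (rho p d e)`_e != 0.
Proof.
move=> eE; have [c c0 ->] := coef_rho p_pr d_gt0 eE (leqnn e).
by rewrite eqxx oppr_eq0.
Qed.

Lemma ord_single i e : (e <= E)%N -> ord e (single i e) /\
  ord e.+1 (single i e - scal (rho p d e)`_e * linform F (a i) (b i) ^+ e).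
Proof.
move=> eE; have r0 j : (j < e)%N -> (rho p d e)`_j = 0.
  move=> je; have [c _ ->] := coef_rho p_pr d_gt0 eE (ltnW je).
  by rewrite ltn_eqF // mulr0n.
have [o1 o2] := ord_emb r0 (@ord_mon_sub1 F (a i) (b i)); split=> //.
have -> : single i e - scal (rho p d e)`_e * linform F (a i) (b i) ^+ e =
  (emb (rho p d e) (mon F (a i) (b i) - 1) - scal (rho p d e)`_e * (mon F (a i) (b i) - 1) ^+ e)
  + scal (rho p d e)`_e * ((mon F (a i) (b i) - 1) ^+ e - linform F (a i) (b i) ^+ e).
  by rewrite mulrBr addrA subrK.
apply: ordD => //; apply: ordMr; elim: (e) => [|n IHn].
  by rewrite !expr0 subrr => ? ? _; rewrite !coef0.
rewrite !exprS -[n.+1]add1n; apply: ordM_congr => //.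
- exact: ord_linform.
- by rewrite -[n in ord n]mul1n; apply: ordX; apply: ord_mon_sub1.
- exact: ord_mon_linform.
Qed.

(** The leading form is a pure power of v; this provides the factor v^beta in the comparison of
    leading monomials. *)
Definition gadget (S : {set I}) (e : nat) :=
  exists P k, [/\ k != 0, spanned S P & ord e.+1 (P - scal k * 'X^e)].

Lemma gadget0 : gadget set0 0.
Proof.
exists 1, 1; split; [exact: oner_neq0 | exact: spanned1 |].
by rewrite scal1 expr0 mul1r subrr => ? ? _; rewrite !coef0.
Qed.

Lemma gadgetM (S S' : {set I}) e e' : [disjoint S & S'] -> gadget S e -> gadget S' e' ->
  gadget (S :|: S') (e + e').
Proof.
move=> dS [P [k [k0 sP oP]]] [P' [k' [k0' sP' oP']]].
exists (P * P'), (k * k'); split; [by rewrite mulf_neq0 | exact: spannedM |].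
rewrite exprD scalM mulrACA; apply: ordM_congr => //; first exact: ord_scal_Xn.
rewrite -(subrK (scal k' * 'X^e') P'); apply: ordD; last exact: ord_scal_Xn.
exact: ord_le oP'.
Qed.

(** Apply [linform_elim] with exponent [E] to two vectors of distinct slopes. Each power of a linear
    form is realised by [single], and dividing by [k (E - e) * k e] normalises the leading
    coefficients. *)
Lemma gadget_pair i j : i != j -> (b i)%:R * (a j)%:R != (b j)%:R * (a i)%:R :> F ->
  gadget [set i; j] E.
Proof.
move=> ij t0; pose u : F := (a j)%:R; pose v : F := - (a i)%:R.
pose c e : F := (u ^+ (E - e) * v ^+ e) *+ 'C(E, e).
pose k e := (rho p d e)`_e.
exists (\sum_(e < E.+1) scal (c e / (k (E - e)%N * k e)) * (single i (E - e) * single j e)).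
exists (((b i)%:R * (a j)%:R - (b j)%:R * (a i)%:R) ^+ E); split.
- by rewrite expf_neq0 // subr_eq0.
- apply: spanned_sum => e _; apply: spannedM; try exact: spanned_single.
  by rewrite disjoints1 inE.
have -> : scal (((b i)%:R * (a j)%:R - (b j)%:R * (a i)%:R) ^+ E) * 'X^E =
  \sum_(e < E.+1) scal (c e) * (linform F (a i) (b i) ^+ (E - e) * linform F (a j) (b j) ^+ e) :> A.
  exact: linform_elim.
rewrite -sumrB; apply: ord_sum => e _; have eE : (e <= E)%N by rewrite -ltnS.
have ke0 : k e != 0 by apply: rho_lead_neq0.
have kE0 : k (E - e)%N != 0 by apply: rho_lead_neq0; apply: leq_subr.
have -> : scal (c e) * (linform F (a i) (b i) ^+ (E - e) * linform F (a j) (b j) ^+ e) =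
  scal (c e / (k (E - e)%N * k e)) * ((scal (k (E - e)%N) * linform F (a i) (b i) ^+ (E - e)) *
     (scal (k e) * linform F (a j) (b j) ^+ e)).
  rewrite [(scal _ * _) * (scal _ * _)]mulrACA [RHS]mulrA -!scalM; congr (scal _ * _).
  by rewrite mulfVK // mulf_neq0.
rewrite -mulrBr; apply: ordMr; rewrite -{1}(subnK eE).
have [o1 o2] := ord_single i (leq_subr e E); have [o3 o4] := ord_single j eE.
apply: ordM_congr => //; apply: ordMr; rewrite -[X in ord X _]mul1n.
by apply: ordX; apply: ord_linform.
Qed.

(** Greedy choice: remove pairs with distinct slopes as long as there are any. If this stops before
    [m] pairs, the remaining vectors share one slope and fewer than 2m vectors were removed. *)
Lemma gadget_pairs m (X : {set I}) : {in X, forall i, (a i)%:R != 0 :> F} ->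
  (exists c : F, (#|[set i in X | ((b i)%:R != c * (a i)%:R :> F)%R]| < m.*2)%N) \/
  (exists S : {set I}, [/\ S \subset X, #|S| = m.*2 & gadget S (m * E)]).
Proof.
elim: m X => [|m IHm] X aX.
  by right; exists set0; rewrite sub0set cards0; split=> //; exact: gadget0.
case: (pickP [pred ij : I * I | [&& ij.1 \in X, ij.2 \in X &
    (b ij.1)%:R * (a ij.2)%:R != (b ij.2)%:R * (a ij.1)%:R :> F]]); last first.
  move=> no; left; have [->|[i iX]] := set_0Vmem X.
    by exists 0; rewrite (_ : [set _ in _ | _] = set0) ?cards0 //; apply/setP=> i; rewrite !inE.
  have e j : j \in X -> (b i)%:R * (a j)%:R = (b j)%:R * (a i)%:R :> F.
    by move=> jX; have /= := no (i, j); rewrite iX jX => /negbFE/eqP.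
  have [c cE] : exists c : F, forall j, j \in X -> (b j)%:R = c * (a j)%:R.
    by exists ((b i)%:R / (a i)%:R) => j /e; rewrite mulrAC => ->; rewrite mulfK // aX.
  exists c; rewrite (_ : [set _ in _ | _] = set0) ?cards0 //; apply/setP=> j; rewrite !inE.
by apply/negbTE/negP=> /andP[/cE->]; rewrite eqxx.
move=> [i j] /and3P[/= iX jX tij].
have ij : i != j by apply: contraNneq tij => ->.
have cij : #|[set i; j]| = 2 by rewrite cards2 ij.
have aX' : {in X :\: [set i; j], forall i, (a i)%:R != 0 :> F}.
  by move=> l; rewrite inE => /andP[_ /aX].
case: (IHm _ aX') => [[c lt_c]|[S [SX cS gS]]].
  have m2 : m.+1.*2 = (m.*2 + #|[set i; j]|)%N by rewrite cij addn2 doubleS.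
  left; exists c; rewrite m2.
  apply: leq_ltn_trans (_ : _ <= #|[set i0 in X :\: [set i; j] | ((b i0)%:R != c * (a i0)%:R :> F)%R] :|: [set i; j]|)%N _.
    apply: subset_leq_card; apply/subsetP=> l; rewrite !inE => /andP[-> ->].
    by case: (l == i); case: (l == j).
  by apply: leq_ltn_trans (leq_card_setU _ _) _; rewrite ltn_add2r.
have dS : [disjoint [set i; j] & S].
  by rewrite disjoint_sym; apply: disjointWl SX _; rewrite disjoints_subset setDE subsetIr.
right; exists ([set i; j] :|: S); split.
- rewrite subUset (subset_trans SX) ?subsetDl // andbT.
  by apply/subsetP=> l; rewrite !inE => /orP[]/eqP->.
- by rewrite cardsU (disjoint_setI0 dS) cards0 subn0 cij cS doubleS.
- by rewrite mulSn; apply: gadgetM => //; exact: gadget_pair.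
Qed.

(** Multiply one [single] per variable, each taking up to [E] of the required degree. Modulo v its
    leading form is a multiple of (a_i u)^e, nonzero since a_i is. *)
Lemma spanned_lead (R : {set I}) al : {in R, forall i, (a i)%:R != 0 :> F} ->
  (al <= #|R| * E)%N ->
  exists P, [/\ spanned R P, ord al P & P`_0`_al != 0].
Proof.
elim: {R}_.+1 {-2}R (ltnSn #|R|) al => // n IHn R Rn al aR alR.
have [R0|[i iR]] := set_0Vmem R.
  move: alR; rewrite R0 cards0 leqn0 => /eqP->; exists 1.
  by split; [exact: spanned1 | exact: ord0 | rewrite !coef1 oner_neq0].
have cR := cardsD1 i R; rewrite iR in cR.
pose e := minn E al; have eE : (e <= E)%N by apply: geq_minl.
have [|||P [sP oP P0]] := IHn (R :\ i) _ (al - e)%N.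
- by move: Rn; rewrite cR.
- by move=> j; rewrite inE => /andP[_ /aR].
- rewrite leq_subLR /e; case: (leqP E al) => _; last exact: leq_addr.
  by rewrite -mulSn; move: alR; rewrite cR.
have [o1 o2] := ord_single i eE.
exists (single i e * P); split.
- rewrite -(setD1K iR); apply: spannedM => //; last exact: spanned_single.
  by rewrite disjoints1 !inE eqxx.
- by rewrite -(subnKC (geq_minr E al)); apply: ordM.
rewrite coefM big_ord1 subn0 -(subnKC (geq_minr E al)) -/e coefM_lead; last 2 first.
- by move=> j je; rewrite o1 // addn0.
- by move=> j je; rewrite oP // addn0.
rewrite mulf_neq0 //.
have := o2 e 0%N; rewrite addn0 ltnSn !coefB => /(_ isT)/eqP; rewrite subr_eq0 => /eqP->.
rewrite coefCM coefCM mulf_neq0 ?rho_lead_neq0 //.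
have -> : (linform F (a i) (b i) ^+ e)`_0 = (a i)%:R ^+ e *: 'X^e.
  rewrite -horner_coef0 horner_exp /linform /scal hornerD !hornerM !hornerC hornerX.
  by rewrite mulr0 addr0 exprMn -polyC_exp mul_polyC.
by rewrite coefZ coefXn eqxx mulr1 expf_neq0 // aR.
Qed.
End Gadgets.

(** * Solutions off a line *)

Lemma exprB1_pchar (R : comNzRingType) (p : nat) (x : R) k : p \in [pchar R] ->
  (x - 1) ^+ (p ^ k) = x ^+ (p ^ k) - 1.
Proof.
move=> pR; have pk : [pchar R].-nat (p ^ k)%N.
  by rewrite (eq_pnat _ (pcharf_eq pR)) pnatX pnat_id ?(pcharf_prime pR).
by rewrite exprDn_pchar // exprNn_pchar // expr1n.
Qed.

(** * Finite differences and Newton interpolation *)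

Section Newton.
Variable F : fieldType.

(** The l-th forward difference of [f] at 0: the linear form sending ['X^z] to [f z], evaluated at
    ('X - 1)^l. *)
Definition newton (f : nat -> F) (l : nat) := pair1 f (('X - 1) ^+ l).

(** Newton's formula: the substitution X -> X - 1 turns (1 + X)^z into X^z. Hence any function of
    the exponents extends to a linear form on polynomials. *)
Lemma newton_eval f z : pair1 (newton f) ((1 + 'X) ^+ z) = f z.
Proof.
have lE P : pair1 (newton f) P = pair1 f (P \Po ('X - 1)).
  rewrite comp_polyE linear_sum; apply: eq_bigr => i _.
  by rewrite linearZ.
rewrite lE rmorphXn rmorphD rmorph1 /= comp_polyX addrC subrK; exact: pair1_Xn.
Qed.

Lemma newton_const l : newton (fun=> 1) l = (l == 0)%:R.
Proof.
have lE P : pair1 (fun=> 1) P = P.[1 : F].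
  by rewrite horner_coef; apply: eq_bigr => i _; rewrite expr1n.
by rewrite /newton lE horner_exp !hornerE subrr expr0n.
Qed.

Definition blockfun (T : nat) (G : nat -> F) (z : nat) :=
  if (T %| z)%N then G (z %/ T)%N else 0.

Lemma pair1_block T G (P R : {poly F}) : (0 < T)%N -> (size R <= T)%N ->
  pair1 (blockfun T G) ((P \Po 'X^T) * R) = R`_0 * pair1 G P.
Proof.
move=> T0 sR; rewrite comp_polyE mulr_suml linear_sum [pair1 G P]/pair1 big_distrr /=.
apply: eq_bigr => i _; rewrite -scalerAl linearZ /= mulrCA; congr (_ * _).
rewrite -[R in LHS]coefK poly_def mulr_sumr linear_sum /=.
have lamk k : (k < T)%N ->
    pair1 (blockfun T G) ('X^T ^+ i * (R`_k *: 'X^k)) = (R`_k * G i) *+ (k == 0)%N.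
  move=> kT; rewrite -scalerAr linearZ /= -exprM -exprD pair1_Xn /blockfun.
  rewrite dvdn_addr ?dvdn_mulr //; case: k kT => [|k] kT.
    by rewrite dvdn0 addn0 mulKn.
  by rewrite gtnNdvd // mulr0.
have [R0|R0] := posnP (size R).
  rewrite [R`_0]nth_default ?R0 // mul0r big1 // => k _.
  by case: k.
rewrite (bigD1 (Ordinal R0)) //= lamk // big1 ?addr0 // => k.
by rewrite -val_eqE /= => k0; rewrite lamk ?(leq_trans _ sR) // (negbTE k0).
Qed.

(** By Frobenius, (X-1)^(l1 p^k + l0) is a polynomial in X^(p^k) times (X-1)^l0. Only exponents
    divisible by p^k count, which leaves the constant term of the second factor. *)
Lemma newton_block (p k l1 l0 : nat) G : p \in [pchar F] -> (l0 < p ^ k)%N ->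
  newton (blockfun (p ^ k) G) (l1 * p ^ k + l0) = (-1) ^+ l0 * newton G l1.
Proof.
move=> pF l0k; have pP : p \in [pchar {poly F}] by rewrite (rmorph_pchar polyC).
have k0 : (0 < p ^ k)%N by apply: leq_ltn_trans l0k.
rewrite /newton exprD mulnC exprM exprB1_pchar //.
have -> : ('X^(p ^ k) - 1) ^+ l1 = (('X - 1) ^+ l1) \Po 'X^(p ^ k) :> {poly F}.
  by rewrite rmorphXn rmorphB rmorph1 /= comp_polyX.
rewrite pair1_block //; last by rewrite -polyC1 size_exp_XsubC.
by rewrite -horner_coef0 horner_exp hornerD hornerN hornerX hornerC add0r.
Qed.

End Newton.

(** * Contradiction when every solution vanishes off the line *)

Section Combinatorial.
Variables (p : nat) (p_pr : prime p) (d : nat) (d_gt0 : (0 < d)%N) (tau : nat).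
Local Notation F := 'F_p.
Local Notation A := {poly {poly F}}.
Local Notation E := (powder p d).
Local Notation Q := (p ^ tau)%N.
Local Notation q := (p ^ tau.+1)%N.
Variables (I : finType) (a b : I -> nat).
Local Notation sm := (@powsum p d I).

Let pF : p \in [pchar F] := pchar_Fp p_pr.

Lemma char_A : p \in [pchar A].
Proof. by rewrite (rmorph_pchar (polyC \o polyC : {rmorphism F -> A})). Qed.

Lemma newton_period_ge k l : (p ^ k <= l)%N -> newton (blockfun (p ^ k) (fun=> 1 : F)) l = 0.
Proof.
move=> kl; have k0 : (0 < p ^ k)%N by rewrite expn_gt0 prime_gt0.
rewrite (divn_eq l (p ^ k)) newton_block ?ltn_pmod // newton_const.
by rewrite eqn0Ngt divn_gt0 // kl mulr0.
Qed.

Definition ind0 : A -> F :=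
  pair2 (newton (blockfun q (fun=> 1))) (newton (blockfun q (fun=> 1))).

Lemma ind0_mon z w : ind0 (mon F z w) = ((q %| z) && (q %| w))%N%:R.
Proof. by rewrite /ind0 pair2_mon !newton_eval /blockfun; do 2!case: ifP => _; rewrite ?mulr1 ?mul0r ?mulr0. Qed.

Lemma ind0_functional : functional ind0. Proof. exact: pair2_functional. Qed.

(** Both indicator functions have Newton coefficients only in degrees at most [q - 1], so [ind0]
    sees no monomial of total degree above 2q - 2. *)
Lemma ind0_ord P : ord (q + q).-1 P -> ind0 P = 0.
Proof. by apply: pair2_ord0 => l; apply: newton_period_ge. Qed.

Variables (X0 Y : {set I}) (dXY : [disjoint X0 & Y]).

(** At [e = E] all weights in [rho] equal 1, so this product is the sum of the monomials at all
    values of the variables in [Y]. *)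
Definition theta : A := \prod_(i in Y) @single p d I a b i E.

Lemma theta_sum : theta = \sum_(y in pffun_on 0 (mem Y) (@predT F)) mon F (sm a Y y) (sm b Y y).
Proof.
rewrite /theta (eq_bigr (fun i => \sum_(x : F) mon F (a i * x ^ d) (b i * x ^ d))); last first.
  move=> i _; rewrite /single emb_rho; apply: eq_bigr => x _.
  by rewrite subnn muln0 expr0 scal1 mul1r addrCA subrr addr0 monX.
rewrite (big_distr_big 0 (mem Y) (@predT F)) /=; apply: eq_bigr => y _.
by rewrite /powsum mon_sum.
Qed.

Lemma ord_theta : ord (#|Y| * E) theta.
Proof.
rewrite /theta -sum1_card big_distrl /=; elim/big_rec2: _ => [|i P n _ oP] //.
by rewrite mul1n; apply: ordM => //; have [] := ord_single p_pr d_gt0 a b i (leqnn E).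
Qed.

(** The number, modulo p, of assignments on [Y] whose values cancel (z,w) modulo [q]. *)
Definition ftheta z w := ind0 (mon F z w * theta).

Lemma fthetaE z w : ftheta z w =
  \sum_(y in pffun_on 0 (mem Y) (@predT F)) ((q %| z + sm a Y y) && (q %| w + sm b Y y))%N%:R.
Proof.
rewrite /ftheta theta_sum mulr_sumr functional_sum; last exact: ind0_functional.
by apply: eq_bigr => y _; rewrite -monD ind0_mon.
Qed.

Lemma ftheta_mod z z' w w' : z = z' %[mod q] -> w = w' %[mod q] -> ftheta z w = ftheta z' w'.
Proof.
move=> zz ww; rewrite !fthetaE; apply: eq_bigr => y _.
by rewrite /dvdn -(modnDml z) zz modnDml -(modnDml w) ww modnDml.
Qed.

Hypothesis no_sol : forall x : I -> F, (q %| sm a (X0 :|: Y) x)%N ->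
  (q %| sm b (X0 :|: Y) x)%N -> {in Y, forall j, x j = 0}.

(** A nonzero count completes [x] to a solution on [X0 :|: Y]; its part on [Y] vanishes by [no_sol],
    so the value on [X] is already 0 modulo [q]. *)
Lemma ftheta_X (X : {set I}) x : X \subset X0 -> ftheta (sm a X x) (sm b X x) != 0 ->
  (q %| sm a X x)%N.
Proof.
move=> XX; rewrite fthetaE; have [|no] := pickP [pred y : {ffun I -> F} |
    (y \in pffun_on 0 (mem Y) (@predT F)) && ((q %| sm a X x + sm a Y y) && (q %| sm b X x + sm b Y y))%N].
  move=> y /and3P[yY qa qb] _; pose z i := if i \in X then x i else if i \in Y then y i else 0.
  have zE c : sm c (X0 :|: Y) z = (sm c X x + sm c Y y)%N.
    rewrite powsumU // -(powsum_extend d_gt0 c x XX); congr (_ + _)%N; apply: eq_bigr => i iS.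
      by rewrite /z (disjointFr dXY).
    rewrite /z iS; case: ifP => // /(subsetP XX) iX0.
    by rewrite (disjointFr dXY iX0) in iS.
  have y0 : {in Y, forall i, y i = 0}.
    move=> i iY; have := no_sol (x := z); rewrite !zE => /(_ qa qb i iY).
    by rewrite /z iY; case: ifP => // /(subsetP XX) iX0; rewrite (disjointFr dXY iX0) in iY.
  have yA : sm a Y y = 0%N.
    by rewrite /powsum big1 // => i iY; rewrite y0 // exp0n ?muln0.
  by move: qa; rewrite yA addn0.
rewrite big1 ?eqxx // => y yY; have := no y; rewrite /= yY /= => ->.
by [].
Qed.

Lemma ftheta00 : ftheta 0 0 = 1.
Proof.
rewrite fthetaE (bigD1 [ffun=> 0]) /=; last first.
  by apply/pffun_onP; split=> //; apply/subsetP=> i; rewrite inE ffunE eqxx.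
rewrite big1 ?addr0 => [|y /andP[/pffun_onP[/subsetP ysup _] y0]].
  rewrite !add0n /powsum big1 ?big1 ?dvdn0 // => i _; by rewrite ffunE exp0n ?muln0.
rewrite !add0n; case: andP => // -[qa qb]; case/eqP: y0; apply/ffunP=> i; rewrite ffunE.
have [iY|/negP iY] := boolP (i \in Y); last first.
  by apply/eqP/negPn/negP=> yi; apply: iY; apply: ysup; rewrite inE.
pose z i := if i \in Y then y i else 0.
have zE c : sm c (X0 :|: Y) z = sm c Y y.
  by apply: powsum_extend => //; apply: subsetUr.
by have := no_sol (x := z); rewrite !zE /z => /(_ qa qb i iY); rewrite iY.
Qed.

Variable r : nat.
Hypothesis r_large : (q + q <= (r * Q + #|Y| * E).+1)%N.
Hypothesis r_lt : (r < p)%N.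

(** The restriction of [ftheta] to the subgroup of order p on the line of slope [c], generated by
    Q(1,c). *)
Definition gline (c n : nat) := ftheta (Q * n) (c * Q * n).

(** With w = [Q(1,c)], Frobenius gives w - 1 = ([(1,c)] - 1)^Q, of order at least [Q]. Together with
    [theta] this reaches order 2q - 1, which [ind0] kills. *)
Lemma pair1_gline c P : pair1 (gline c) (P * ('X - 1) ^+ r) = 0.
Proof.
pose w := mon F Q (c * Q).
have gE f : pair1 (gline c) f = ind0 (emb f w * theta).
  rewrite emb_coef mulr_suml functional_sum; last exact: ind0_functional.
  apply: eq_bigr => j _; rewrite -mulrA functionalZ; last exact: ind0_functional.
  by rewrite -monX.
rewrite gE; apply: ind0_ord.
have -> : emb (P * ('X - 1) ^+ r) w = emb P w * (w - 1) ^+ r.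
  rewrite /emb rmorphM hornerM; congr (_ * _).
  by rewrite rmorphXn horner_exp rmorphB rmorph1 /= map_polyX hornerD hornerN hornerX hornerC.
rewrite -mulrA; apply: ordMr; apply: (@ord_le _ _ (r * Q + #|Y| * E)).
  by rewrite -ltnS prednK // addn_gt0 expn_gt0 prime_gt0.
apply: ordM; last exact: ord_theta.
have -> : w - 1 = (mon F 1 c - 1) ^+ Q.
  by rewrite exprB1_pchar ?char_A // -monX mul1n.
apply: (@ord_le _ _ (1 * (Q * r))); first by rewrite mul1n mulnC.
by rewrite -exprM; apply: ordX; apply: ord_mon_sub1.
Qed.

(** The factor [n] removes the point 0, where [ftheta] equals 1, so that the product vanishes at
    every value taken by the variables on the line. *)
Definition Gline c n : F := n%:R * gline c n.

(** Multiplication by [n] is dual to P -> X P', and differentiating (X-1)^l lowers the exponent by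
    only one. *)
Lemma newton_Gline c l : (r < l)%N -> newton (Gline c) l = 0.
Proof.
move=> rl.
have GX n : pair1 (gline c) ('X * ('X^n)^`()) = Gline c n.
  rewrite derivXn /Gline; case: n => [|n]; first by rewrite mulr0n mulr0 linear0 mul0r.
  by rewrite mulrnAr -exprS linearMn /= pair1_Xn mulr_natl.
have GE P : pair1 (Gline c) P = pair1 (gline c) ('X * P^`()).
  rewrite -[P]coefK poly_def [in RHS]linear_sum mulr_sumr !linear_sum; apply: eq_bigr => i _.
  by rewrite [in RHS]linearZ -scalerAr !linearZ /= pair1_Xn GX.
rewrite /newton GE -polyC1 deriv_exp derivXsubC mul1r -(subnK (_ : (r <= l.-1)%N)); last first.
  by rewrite -ltnS prednK // (leq_ltn_trans _ rl).
by rewrite exprD mulrnAr -mulrnAl mulrA polyC1 pair1_gline.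
Qed.

(** Otherwise [gline] would vanish at 0 < n < p. Pairing it with (X-1)^(p-1), which gives 0 by
    [pair1_gline], would leave the constant term (-1)^(p-1) times [ftheta 0 0 = 1]. *)
Lemma newton_Gline_neq0 c : exists l, newton (Gline c) l != 0.
Proof.
have [[l _] /= Gl|G0] := pickP (fun l : 'I_r.+1 => newton (Gline c) l != 0).
  by exists l.
have G_0 n : Gline c n = 0.
  rewrite -newton_eval /pair1 big1 // => i _; apply/eqP; rewrite mulf_eq0; apply/orP; right.
  have [ir|ri] := ltnP i r.+1; first by have /negbFE := G0 (Ordinal ir).
  by rewrite newton_Gline.
have g0 n : (0 < n < p)%N -> gline c n = 0.
  move=> /andP[n0 np]; have /eqP := G_0 n; rewrite mulf_eq0 => /orP[|/eqP //].
  by rewrite -(dvdn_pcharf pF) gtnNdvd.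
have rp : (r <= p.-1)%N by rewrite -ltnS prednK ?prime_gt0.
have := pair1_gline c (('X - 1) ^+ (p.-1 - r)); rewrite -exprD subnK //.
rewrite (@pair1E _ p); last by rewrite -polyC1 size_exp_XsubC prednK ?prime_gt0.
have p0 := prime_gt0 p_pr; rewrite (bigD1 (Ordinal p0)) //= big1 ?addr0; last first.
  by move=> i; rewrite -val_eqE /= => i0; rewrite g0 ?mulr0 // lt0n i0 ltn_ord.
rewrite /gline !muln0 ftheta00 mulr1 -horner_coef0 horner_exp hornerD hornerN hornerX hornerC add0r.
by move/eqP; rewrite expf_eq0 oppr_eq0 oner_eq0 andbF.
Qed.

Lemma r_gt0 : (0 < r)%N.
Proof.
have [l] := newton_Gline_neq0 0; apply: contraNltn; rewrite leqn0 => /eqP r0.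
case: l => [|l]; last by rewrite newton_Gline // r0.
by rewrite /newton expr0 -(expr0 'X) pair1_Xn /Gline mul0r.
Qed.

Lemma Gline_top c : exists2 m, (m <= r)%N &
  newton (Gline c) m != 0 /\ forall l, (m < l)%N -> newton (Gline c) l = 0.
Proof.
have ub l : newton (Gline c) l != 0 -> (l <= r)%N.
  by apply: contraNT; rewrite -ltnNge => /newton_Gline->.
case: (ex_maxnP (newton_Gline_neq0 c) ub) => m Gm mmax; exists m; first exact: ub.
by split=> // l; apply: contraTeq => /mmax; rewrite -leqNgt.
Qed.

Hypothesis aX0 : {in X0, forall i, (a i)%:R != 0 :> F}.

(** The function Phi(A) Psi(B') vanishes at all values of (a,b') on [X]: if A = Qn and p^h divides
    B', then (A,B) is congruent to Q(n,cn) modulo [q], and [ftheta_X] gives p | n unless [ftheta] is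
    0 there. But the gadget on [S] times an element from [X :\: S] is spanned by these values and
    has a nonzero coefficient at the top Newton degrees of Phi and Psi, against [pair2_top]. *)
Lemma no_top_gadget (c i h : nat) (b' : I -> nat) (X S : {set I}) :
  (i + h)%N = tau.+1 -> X \subset X0 -> S \subset X ->
  {in X, forall j, c * a j + p ^ i * b' j = b j %[mod q]} ->
  @gadget p d I a b' S (p ^ h).-1 -> (r * Q + Q.-1 <= #|X :\: S| * E)%N -> False.
Proof.
move=> ih XX SX bX gS lXS; have [m mr [Gm Gm0]] := Gline_top c.
have Q0 k : (0 < p ^ k)%N by rewrite expn_gt0 prime_gt0.
pose Phi := blockfun Q (Gline c); pose Psi := blockfun (p ^ h) (fun=> 1 : F).
pose al := (m * Q + Q.-1)%N; pose be := (p ^ h).-1.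
have aXS : {in X :\: S, forall j, (a j)%:R != 0 :> F}.
  by move=> j; rewrite inE => /andP[_ /(subsetP XX)/aX0].
have alXS : (al <= #|X :\: S| * E)%N.
  by apply: leq_trans lXS; rewrite leq_add2r leq_mul2r mr orbT.
have [P2 [sP2 oP2 P20]] := spanned_lead p_pr d_gt0 b' aXS alXS.
have [P1 [k [k0 sP1 oP1]]] := gS.
have sP : spanned d a b' X (P1 * P2).
  have XE : X = S :|: (X :\: S) by rewrite -{1}[X](setID X S) (setIidPr SX).
  rewrite [in spanned _ _ _ _]XE; apply: spannedM => //.
  by rewrite disjoint_sym disjoints_subset setDE subsetIr.
have phi_top : newton Phi al != 0.
  by rewrite /Phi newton_block ?prednK ?leqnn // mulf_neq0 // expf_neq0 // oppr_eq0 oner_eq0.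
have phi0 l : (al < l)%N -> newton Phi l = 0.
  move=> all; rewrite (divn_eq l Q) newton_block ?ltn_pmod // Gm0 ?mulr0 //.
  by rewrite leq_divRL // mulSn addnC; move: all; rewrite /al -addnS prednK.
have psi_top : newton Psi be != 0.
  rewrite (_ : be = 0 * p ^ h + be)%N // newton_block ?prednK //.
  by rewrite newton_const mulr1 expf_neq0 // oppr_eq0 oner_eq0.
have psi0 l : (be < l)%N -> newton Psi l = 0.
  by move=> bl; apply: newton_period_ge; rewrite -(prednK (Q0 h)).
have : pair2 (newton Phi) (newton Psi) (P1 * P2) = 0.
  apply: sP; first exact: pair2_functional.
  move=> x; rewrite pair2_mon !newton_eval /Phi /Psi /blockfun.
  case: ifP => [/dvdnP[n An]|_]; last by rewrite mul0r.
  case: ifP => [/dvdnP[n' Bn]|_]; last by rewrite mulr0.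
  rewrite mulr1 An mulnK // /Gline; apply/eqP; rewrite mulf_eq0 orbC -implyNb.
  apply/implyP=> gn; rewrite -(dvdn_pcharf pF).
  have := ftheta_X (x := x) XX; rewrite An.
  rewrite (@ftheta_mod _ (Q * n) _ (c * Q * n)); last 2 first.
  - by rewrite mulnC.
  - have <- : (c * sm a X x + p ^ i * sm b' X x)%N = c * Q * n %[mod q].
      by rewrite An Bn (mulnCA (p ^ i)%N) -expnD ih addnC modnMDl mulnAC mulnA.
    rewrite /powsum !big_distrr -big_split /=.
    elim/big_rec2: _ => // j y1 y2 jX yy; rewrite -modnDm yy -(modnMml (b j)) -bX //.
    by rewrite modnMml modnDm !mulnA mulnDl.
  by move=> /(_ gn); rewrite expnS dvdn_pmul2r.
rewrite (pair2_top phi0 psi0).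
  by rewrite (coef_top_mul oP1 oP2) => /eqP; rewrite !mulf_eq0 !(negbTE k0, negbTE P20, negbTE phi_top, negbTE psi_top).
rewrite addnC; apply: ordM => //.
rewrite -(subrK (scal k * 'X^be) P1); apply: ordD; last exact: ord_scal_Xn.
exact: ord_le oP1.
Qed.

(* [loss h] bounds [E] times the number of variables given up while passing
   from the line modulo [p ^ (tau.+1 - h)] to a line modulo [p ^ tau.+1]. *)
Fixpoint loss h := ((p ^ h).-1.*2 + if h is h'.+1 then loss h' else 0)%N.

Lemma powder_dvd h : (E %| (p ^ h).-1)%N.
Proof.
apply: dvdn_trans (_ : p.-1 %| _)%N; last by rewrite predn_exp dvdn_mulr.
by apply/dvdnP; exists (gcdn d p.-1); rewrite mulnC divnK // dvdn_gcdr.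
Qed.

(** Seek (p^h - 1)/E pairs with distinct slopes for (a,b'). If they exist, [no_top_gadget] applies;
    if not, most of [X] has a common slope t for (a,b'), hence slope c + p^i t modulo p^(i+1) for
    (a,b). *)
Lemma refine_line h c (X : {set I}) : (h <= tau)%N -> X \subset X0 ->
  {in X, forall j, c * a j = b j %[mod p ^ (tau.+1 - h)]} ->
  (r * Q + Q.-1 + (p ^ h).-1.*2 <= #|X| * E)%N ->
  (0 < h)%N /\ exists c' (X' : {set I}), [/\ X' \subset X,
    {in X', forall j, c' * a j = b j %[mod p ^ (tau.+1 - h).+1]} &
    (#|X| * E <= #|X'| * E + (p ^ h).-1.*2)%N].
Proof.
move=> hX XX bX lX; set i := (tau.+1 - h)%N in bX *.
have ih : (i + h)%N = tau.+1 by rewrite subnK // ltnW.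
pose D := ((p ^ h).-1 %/ E)%N.
have DE : (D * E)%N = (p ^ h).-1 by rewrite divnK // powder_dvd.
have pi0 : (0 < p ^ i)%N by rewrite expn_gt0 prime_gt0.
have q0 : (0 < q)%N by rewrite expn_gt0 prime_gt0.
(* This is (b - c a) / p^i modulo [q], with [q.-1] standing for -1 to stay in the natural
   numbers. *)
pose b' j := ((b j + q.-1 * (c * a j)) %/ p ^ i)%N.
have b'E j : j \in X -> (p ^ i * b' j = b j + q.-1 * (c * a j))%N.
  move=> jX; rewrite mulnC divnK // /dvdn -(modnDml (b j)) -bX // modnDml.
  by rewrite -mulSn prednK // -ih expnD -mulnA modnMr.
have b'q : {in X, forall j, c * a j + p ^ i * b' j = b j %[mod q]}.
  by move=> j jX; rewrite b'E // addnCA -mulSn prednK // addnC [(p ^ _ * _)%N]mulnC modnMDl.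
have aX : {in X, forall j, (a j)%:R != 0 :> F} by move=> j /(subsetP XX)/aX0.
have [[t]|[S [SX cS gS]]] := gadget_pairs p_pr d_gt0 b' D aX; last first.
  rewrite DE in gS; case: (no_top_gadget ih XX SX b'q gS).
  by rewrite cardsDS // cS mulnBl -doubleMl DE; apply: leq_trans (leq_sub2r _ lX); rewrite addnK.
set Z := [set j in X | _] => lZ.
(* For [h = 0] no pair is required, so the second alternative of [gadget_pairs] is impossible. *)
have h0 : (0 < h)%N by move: lZ; rewrite /D; case: (h) => // ; rewrite expn0 div0n.
split=> //; exists (c + p ^ i * (t : nat))%N, (X :\: Z); split; first exact: subsetDl.
  move=> j; rewrite !inE => /andP[]; move=> + jX; rewrite jX negbK => /eqP tj.
  have tj' : b' j = t * a j %[mod p].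
    by rewrite -!(val_Fp_nat p_pr) tj natrM natr_Zp.
  have : (p ^ i * b' j = p ^ i * (t * a j) %[mod p ^ i.+1])%N.
    by rewrite expnSr -!muln_modr tj'.
  have : c * a j + p ^ i * b' j = b j %[mod p ^ i.+1].
    have iq : (p ^ i.+1 %| q)%N by rewrite dvdn_exp2l // -ih -addn1 leq_add2l.
    by rewrite -(modn_dvdm _ iq) b'q // modn_dvdm.
  by move=> <- e; rewrite mulnDl -mulnA -modnDmr -e modnDmr.
have cZ : (#|X| = #|X :\: Z| + #|Z|)%N.
  by rewrite cardsD (setIidPr _) ?subnK ?subset_leq_card //; apply/subsetP=> j; rewrite inE => /andP[].
by rewrite {1}cZ mulnDl leq_add2l -DE doubleMl leq_mul2r ltnW ?orbT.
Qed.

Lemma no_sol_absurd h c (X : {set I}) : (h <= tau)%N -> X \subset X0 ->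
  {in X, forall j, c * a j = b j %[mod p ^ (tau.+1 - h)]} ->
  (r * Q + Q.-1 + loss h <= #|X| * E)%N -> False.
Proof.
elim: h c X => [|h IHh] c X hX XX bX lX.
  by have [] := refine_line hX XX bX lX.
have [|_ [c' [X' [XX' bX' lX']]]] := refine_line hX XX bX.
  by apply: leq_trans lX; rewrite leq_add2l leq_addr.
apply: (IHh c' X'); first exact: ltnW.
- exact: subset_trans XX' XX.
- by rewrite (_ : tau.+1 - h = (tau.+1 - h.+1).+1)%N // subSS subSn // ltnW.
move: lX lX'; rewrite /= => lX lX'; rewrite -(leq_add2r (p ^ h.+1).-1.*2).
by apply: leq_trans lX'; apply: leq_trans lX; rewrite addnAC !addnA.
Qed.

End Combinatorial.

Lemma loss_le p h : (1 < p)%N -> (loss p h <= (p ^ h).-1 * 4)%N.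
Proof.
move=> p1; elim: h => [|h IHh] //=; rewrite expnS.
have : (0 < p ^ h)%N by rewrite expn_gt0 ltnW.
have : (2 * p ^ h <= p * p ^ h)%N by rewrite leq_mul2r p1 orbT.
move: IHh; move: (loss p h) (p ^ h)%N (p * p ^ h)%N; lia.
Qed.

Theorem solution_off_line (p : nat) (p_pr : prime p) (d tau : nat) (I : finType)
    (a b : I -> nat) (c : nat) (X Y : {set I}) :
  (0 < d)%N -> [disjoint X & Y] ->
  {in X, forall i, ~~ (p %| a i)%N} ->
  {in X, forall i, c * a i = b i %[mod p]} ->
  ((p ^ tau.+1).*2 + 6 * p ^ tau <= (#|X| + #|Y|) * powder p d + 7)%N ->
  (p ^ tau.+1 + p ^ tau <= (#|Y| * powder p d).+1)%N ->
  exists x : I -> 'F_p, [/\ (p ^ tau.+1 %| powsum d a (X :|: Y) x)%N,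
    (p ^ tau.+1 %| powsum d b (X :|: Y) x)%N & exists2 j, j \in Y & x j != 0].
Proof.
move=> d0 dXY aX bX H1 H2; set E := powder p d in H1 H2.
have [x /and3P[qa qb /existsP[j /andP[jY xj]]]|no] := pickP (fun x : {ffun I -> 'F_p} =>
    [&& (p ^ tau.+1 %| powsum d a (X :|: Y) x)%N, (p ^ tau.+1 %| powsum d b (X :|: Y) x)%N
      & [exists j, (j \in Y) && (x j != 0)]]).
  by exists x; split=> //; exists j.
exfalso; pose Q := (p ^ tau)%N; have Q0 : (0 < Q)%N by rewrite expn_gt0 prime_gt0.
have no_sol (x : I -> 'F_p) : (p ^ tau.+1 %| powsum d a (X :|: Y) x)%N ->
    (p ^ tau.+1 %| powsum d b (X :|: Y) x)%N -> {in Y, forall j, x j = 0}.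
  move=> qa qb j jY; apply/eqP/negPn/negP=> xj; have := no [ffun i => x i].
  have fE c' : powsum d c' (X :|: Y) [ffun i => x i] = powsum d c' (X :|: Y) x.
    by apply: eq_bigr => i _; rewrite ffunE.
  by rewrite /= !fE qa qb => /negbT/existsPn/(_ j); rewrite jY ffunE xj.
(* The integer [r] is K/Q rounded up, the least value with rQ + |Y|E >= 2q - 1. The bound on [Y]
   gives K <= q - Q and hence [r < p]. *)
pose K := ((p ^ tau.+1).*2.-1 - #|Y| * E)%N.
pose r := ((K + Q.-1) %/ Q)%N.
have p1 := prime_gt1 p_pr.
have KrQ : (K <= r * Q)%N.
  have := divn_eq (K + Q.-1) Q; have := ltn_pmod (K + Q.-1) Q0; rewrite -/r.
  by move: (_ %% _)%N (r * Q)%N; lia.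
have rQK : (r * Q <= K + Q.-1)%N by apply: leq_divM.
have qE : (p ^ tau.+1 = p * Q)%N by rewrite expnS.
have r1 : (p ^ tau.+1 + p ^ tau.+1 <= (r * p ^ tau + #|Y| * E).+1)%N.
  by move: KrQ; rewrite /K addnn -/Q; move: (r * Q)%N (#|Y| * E)%N; lia.
have r2 : (r < p)%N.
  rewrite -(ltn_pmul2r Q0); apply: leq_ltn_trans rQK _; rewrite /K qE.
  by move: H2 p1; rewrite qE -/Q; move: (#|Y| * E)%N => y; nia.
(* Positivity of [r] excludes truncation in [K]. Then rQ + (Q-1) + 4(Q-1) is at most 2q - 1 - |Y|E +
   6(Q-1), whence the constants 6 and 7. *)
have r0 := r_gt0 p_pr d0 no_sol r1 r2.
apply: (no_sol_absurd p_pr d0 dXY no_sol r1 r2 _ (leqnn tau) (subxx X) (c := c)).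
- by move=> i iX; rewrite -(dvdn_pcharf (pchar_Fp p_pr)) aX.
- by rewrite subSnn expn1.
have := loss_le tau p1; rewrite -/Q mulnDl -/E in H1 *; move: H1 rQK.
have : (Q <= r * Q)%N by rewrite leq_pmull.
rewrite /K; move: (loss _ _) (r * Q)%N (#|X| * E)%N (#|Y| * E)%N (p ^ tau.+1)%N; lia.
Qed.

(** * Nonsingular solutions *)

Section Nonsingular.
Variables (p : nat) (p_pr : prime p) (d tau : nat) (d_gt0 : (0 < d)%N).
Variables (I : finType) (a b : I -> nat) (J : {set I}).
Local Notation F := 'F_p.
Local Notation E := (powder p d).

Definition detF i j : F := (a i)%:R * (b j)%:R - (a j)%:R * (b i)%:R.

Hypothesis J_prim : {in J, forall i, ~~ ((p %| a i) && (p %| b i))%N}.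
Hypothesis J_large : ((p ^ tau.+1).*2 + 6 * p ^ tau <= #|J| * E + 7)%N.
Hypothesis off_line_large : {in J, forall l,
  (p ^ tau.+1 + p ^ tau <= (#|[set j in J | detF l j != 0%R]| * E).+1)%N}.

Local Notation sol x := ((p ^ tau.+1 %| powsum d a J x) && (p ^ tau.+1 %| powsum d b J x))%N.

Lemma solution_off l : l \in J -> exists x : I -> F, sol x /\
  exists j, [/\ j \in J, x j != 0 & detF l j != 0].
Proof.
move=> lJ; pose X := [set j in J | detF l j == 0]; pose Y := [set j in J | detF l j != 0].
have F0 n : (p %| n)%N = (n%:R == 0 :> F) by rewrite (dvdn_pcharf (pchar_Fp p_pr)).
have XY : X :|: Y = J.
  by apply/setP=> j; rewrite !inE -andb_orr orbN andbT.
have dXY : [disjoint X & Y].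
  by rewrite disjoints_subset; apply/subsetP=> j; rewrite !inE => /andP[-> ->].
have H1 : ((p ^ tau.+1).*2 + 6 * p ^ tau <= (#|X| + #|Y|) * E + 7)%N.
  by rewrite -cardsUI (disjoint_setI0 dXY) cards0 addn0 XY.
have H2 := off_line_large lJ.
have prim j : j \in J -> (a j)%:R = 0 :> F -> (b j)%:R != 0 :> F.
  by move=> jJ aj; have := J_prim jJ; rewrite !F0 aj eqxx.
(* When p divides a_l the line is a = 0, which has no slope b/a; the two forms are exchanged and the
   slope is 0. *)
have [al|al] := boolP (p %| a l)%N.
  have al0 : (a l)%:R = 0 :> F by apply/eqP; rewrite -F0.
  have bl := prim _ lJ al0.
  have aX j : j \in X -> (a j)%:R = 0 :> F.
    rewrite inE /detF al0 mul0r sub0r oppr_eq0 mulf_eq0 (negbTE bl) orbF.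
    by case/andP=> _ /eqP.
  have [||x [qb qa [j jY xj]]] := solution_off_line p_pr (a := b) (b := a) (c := 0) d_gt0 dXY _ _ H1 H2.
  - by move=> j jX; rewrite F0 prim ?aX //; move: jX; rewrite inE => /andP[].
  - by move=> j jX; rewrite mul0n mod0n; apply/esym/eqP; rewrite -/(dvdn _ _) F0 aX.
  exists x; rewrite -{1 2}XY qa qb; split=> //; exists j; move: jY; rewrite inE => /andP[] //.
pose c : F := (b l)%:R / (a l)%:R.
have al0 : (a l)%:R != 0 :> F by rewrite -F0.
have bX j : j \in X -> (b j)%:R = c * (a j)%:R.
  rewrite inE /detF subr_eq0 => /andP[_ /eqP e]; apply: (mulfI al0); rewrite e /c.
  by rewrite mulrA [_ * (_ / _)]mulrC divfK // mulrC.
have [||x [qa qb [j jY xj]]] := solution_off_line p_pr (a := a) (b := b) (c := c) d_gt0 dXY _ _ H1 H2.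
- move=> j jX; rewrite F0; apply/negP=> /eqP aj.
  have jJ : j \in J by move: jX; rewrite inE => /andP[].
  by have := prim _ jJ aj; rewrite bX // aj mulr0 eqxx.
- by move=> j jX; rewrite -!(val_Fp_nat p_pr) bX // natrM natr_Zp.
exists x; rewrite -{1 2}XY qa qb; split=> //; exists j; move: jY; rewrite inE => /andP[] //.
Qed.

(* If a solution off the line of [l] is supported on a line, a solution off
   that second line either is nonsingular or has disjoint support, and then
   the two can be added. *)
Theorem nonsingular_solution : exists x : I -> F, sol x /\
  exists i j, [/\ i \in J, j \in J, x i != 0, x j != 0 & detF i j != 0].
Proof.
have [l lJ] : exists l, l \in J.
  apply/set0Pn; apply/eqP=> J0; move: J_large; rewrite J0 cards0 mul0n leqNgt.
  have : (0 < p ^ tau)%N by rewrite expn_gt0 prime_gt0.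
  have : (2 * p ^ tau <= p ^ tau.+1)%N by rewrite expnS leq_mul2r prime_gt1 ?orbT.
  by move: (p ^ tau)%N (p ^ tau.+1)%N; lia.
have [x1 [s1 [j1 [j1J x1j1 _]]]] := solution_off lJ.
have [i /and3P[iJ xi di]|no1] := pickP [pred i | [&& i \in J, x1 i != 0 & detF i j1 != 0]].
  by exists x1; split=> //; exists i, j1.
have [x2 [s2 [j2 [j2J x2j2 d12]]]] := solution_off j1J.
have [i /and3P[iJ xi di]|no2] := pickP [pred i | [&& i \in J, x2 i != 0 & detF i j2 != 0]].
  by exists x2; split=> //; exists i, j2.
have lin1 i : i \in J -> x1 i != 0 -> detF i j1 = 0.
  by move=> iJ xi; have := no1 i; rewrite /= iJ xi => /negbFE/eqP.
have lin2 i : i \in J -> x2 i != 0 -> detF i j2 = 0.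
  by move=> iJ xi; have := no2 i; rewrite /= iJ xi => /negbFE/eqP.
have disj i : i \in J -> x1 i != 0 -> x2 i = 0.
  move=> iJ x1i; apply/eqP/negPn/negP=> x2i.
  have e1 := lin1 _ iJ x1i; have e2 := lin2 _ iJ x2i.
  (* A vector parallel modulo p to two independent vectors is 0 modulo p, contradicting
     primitivity. *)
  have ai : (a i)%:R * detF j1 j2 = (a j1)%:R * detF i j2 - (a j2)%:R * detF i j1.
    by rewrite /detF; ring.
  have bi : (b i)%:R * detF j1 j2 = (b j1)%:R * detF i j2 - (b j2)%:R * detF i j1.
    by rewrite /detF; ring.
  rewrite e1 e2 !mulr0 subrr in ai bi.
  move/eqP: ai; move/eqP: bi; rewrite !mulf_eq0 !(negbTE d12) !orbF => bi ai.
  by have := J_prim iJ; rewrite !(dvdn_pcharf (pchar_Fp p_pr)) ai bi.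
pose x i := if x1 i == 0 then x2 i else x1 i.
have xE c : powsum d c J x = (powsum d c J x1 + powsum d c J x2)%N.
  rewrite /powsum -big_split /=; apply: eq_bigr => i iJ; rewrite /x.
  case: eqP => [->|/eqP x1i]; first by rewrite exp0n // muln0.
  by rewrite disj // exp0n // muln0 addn0.
exists x; rewrite !xE; case/andP: s1 => s1a s1b; case/andP: s2 => s2a s2b.
rewrite !dvdn_add //; split=> //; exists j1, j2; split=> //; rewrite /x.
  by rewrite (negbTE x1j1).
by case: ifP => // /negbT x1j2; rewrite disj ?eqxx // in x2j2.
Qed.
End Nonsingular.

(** * Roots in Z_p *)

Section Binomial.
Variable R : comNzRingType.

Lemma expr1D_order2 (z : R) n : exists B, (1 + z) ^+ n = 1 + n%:R * z + z ^+ 2 * B.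
Proof.
elim: n => [|n [B IHn]]; first by exists 0; rewrite expr0; ring.
by exists (B * (1 + z) + n%:R); rewrite exprSr IHn -natr1; ring.
Qed.

Lemma expr1D_order3 (z : R) n :
  exists B, (1 + z) ^+ n = 1 + n%:R * z + 'C(n, 2)%:R * z ^+ 2 + z ^+ 3 * B.
Proof.
elim: n => [|n [B IHn]]; first by exists 0; rewrite expr0 bin0n /=; ring.
exists (B * (1 + z) + 'C(n, 2)%:R).
by rewrite exprSr IHn binS bin1 natrD -natr1; ring.
Qed.

(** Each p-th power gains one factor p. The quadratic term is harmless because p > 2 divides
    ['C(p, 2)], the cubic one because m + k > 0. *)
Lemma expr1D_pfactor (p : nat) (t : R) m k : prime p -> (2 < p)%N -> (0 < m)%N ->
  exists s, (1 + p%:R ^+ m * t) ^+ (p ^ k) = 1 + p%:R ^+ (m + k) * (t + p%:R * s).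
Proof.
move=> p_pr p2 m0; elim: k => [|k [s IHk]]; first by exists 0; rewrite expn0 expr1 addn0; ring.
set y := t + p%:R * s in IHk.
have [B BE] := expr1D_order3 (p%:R ^+ (m + k) * y) p.
have /dvdnP[c cE] : (p %| 'C(p, 2))%N by apply: prime_dvd_bin.
have mk0 : (0 < m + k)%N by rewrite addn_gt0 m0.
exists (s + c%:R * p%:R ^+ (m + k).-1 * y ^+ 2 + p%:R ^+ ((m + k).-1 + (m + k).-1) * y ^+ 3 * B).
rewrite expnSr exprM IHk BE cE natrM addnS.
rewrite -(prednK mk0) /= !exprS exprD /y; ring.
Qed.

Lemma expr1D_root (p : nat) (t : R) m k d0 : prime p -> (2 < p)%N -> (0 < m)%N ->
  exists s, (1 + p%:R ^+ m * t) ^+ (d0 * p ^ k) =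
    1 + d0%:R * p%:R ^+ (m + k) * t + p%:R ^+ (m + k).+1 * s.
Proof.
move=> p_pr p2 m0; have [s sE] := expr1D_pfactor t k p_pr p2 m0.
have [B BE] := expr1D_order2 (p%:R ^+ (m + k) * (t + p%:R * s)) d0.
have mk0 : (0 < m + k)%N by rewrite addn_gt0 m0.
exists (d0%:R * s + p%:R ^+ (m + k).-1 * (t + p%:R * s) ^+ 2 * B).
rewrite mulnC exprM sE BE -(prednK mk0) /= !exprS; ring.
Qed.
End Binomial.

(** * Divisibility, units and d-th powers in Z_p *)

Section Padic.
Variables (p : nat) (p_pr : prime p).
Local Notation Zp := (padic_int p_pr).
Implicit Types x y z : Zp.

Let p_gt0 := prime_gt0 p_pr.
Let pn_gt0 n : (0 < p ^ n)%N. Proof. by rewrite expn_gt0 p_gt0. Qed.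

Lemma padic_res_nat k n : (k%:R : Zp) n = (k %% p ^ n)%N.
Proof.
elim: k => [|k IHk]; first by rewrite mulr0n padic_res0 mod0n.
by rewrite -natr1 padic_resD IHk padic_res1 modnDm addn1.
Qed.

Lemma padic_resX x k n : (x ^+ k) n = (x n ^ k %% p ^ n)%N.
Proof.
elim: k => [|k IHk]; first by rewrite expr0 expn0 padic_res1.
by rewrite exprS expnS padic_resM IHk modnMmr.
Qed.

Lemma padic_res_sum (J : Type) (r : seq J) (T : pred J) (f : J -> Zp) n :
  (\sum_(i <- r | T i) f i) n = ((\sum_(i <- r | T i) f i n) %% p ^ n)%N.
Proof.
elim/big_rec2: _ => [|i y1 y2 _ yE]; first by rewrite padic_res0 mod0n.
by rewrite padic_resD yE modnDmr.
Qed.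

Definition pdvd n x := exists z, x = p%:R ^+ n * z.

Lemma pdvdP n x : pdvd n x <-> x n = 0%N.
Proof.
split=> [[z ->]|].
  by rewrite padic_resM padic_resX padic_res_nat modnXm modnn mul0n mod0n.
elim: n x => [|n IHn] x xn; first by exists x; rewrite expr0 mul1r.
have px k : (p %| x k.+1)%N.
  rewrite /dvdn -[p in (_ %% p)%N]expn1 modn_padic_res //.
  by rewrite -(modn_padic_res x (ltn0Sn n)) xn mod0n.
have yP k : (x k.+2 %/ p = x k.+1 %/ p %[mod p ^ k])%N.
  have e := divn_eq (x k.+2) (p ^ k.+1); rewrite padic_resS in e.
  rewrite [in LHS]e expnS mulnCA -{1}(divnK (px k)).
  by rewrite [(_ * p)%N]mulnC -mulnDr mulKn // modnMDl.
(* The quotient x/p: residues are shifted by one level and divided by p. *)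
pose y := padic_reduce p_pr yP.
have xE : x = p%:R * y.
  apply: padic_intP => k; rewrite padic_resM padic_res_nat /= modnMm mulnC divnK //.
  by rewrite modn_padic_res.
have [|z zE] := IHn y; last by exists z; rewrite xE zE exprS mulrA.
apply/eqP; rewrite /= -/(dvdn _ _) -(dvdn_pmul2r p_gt0) divnK // -expnSr.
by rewrite xn dvdn0.
Qed.

Lemma pdvd_sub n x y : pdvd n (x - y) <-> x n = y n.
Proof.
split=> [[z /eqP]|xy].
  rewrite subr_eq => /eqP->; rewrite padic_resD.
  by rewrite (_ : (p%:R ^+ n * z) n = 0%N) ?add0n ?modn_padic_id //; apply/pdvdP; exists z.
apply/pdvdP; have : (x - y + y) n = x n by rewrite subrK.
rewrite padic_resD -xy => /eqP; rewrite -{2}(modn_padic_id x) -{2}[x n]add0n eqn_modDr mod0n.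
by rewrite modn_padic_id => /eqP.
Qed.

Lemma padic_unitE x : (x \is a GRing.unit) = (x 1 != 0%N).
Proof.
apply/idP/idP => [/unitrP[y [yx _]]|x1].
  apply/eqP=> x1; have : (y * x) 1 = (1 : Zp) 1 by rewrite yx.
  by rewrite padic_resM x1 muln0 mod0n padic_res1 modn_small // expn1 prime_gt1.
have cop n : coprime (x n.+1) (p ^ n.+1).
  rewrite coprime_pexpr // coprime_sym prime_coprime //.
  by rewrite /dvdn -[p in (_ %% p)%N]expn1 modn_padic_res.
have cop' n : coprime (x n) (p ^ n) by case: n => // ; rewrite expn0 coprimen1.
(* Euler's theorem gives the inverse at every level, and uniqueness of inverses makes these
   compatible. *)
pose inv n := (x n ^ (totient (p ^ n)).-1)%N.
have invE n : (x n * inv n = 1 %[mod p ^ n])%N.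
  by rewrite /inv -expnS prednK ?totient_gt0 // Euler_exp_totient.
have invP n : (inv n.+1 = inv n %[mod p ^ n])%N.
  have e : (inv n.+1 * x n = 1 %[mod p ^ n])%N.
    rewrite -padic_resS modnMmr mulnC.
    by rewrite -(modn_dvdm _ (dvdn_exp2l p (leqnSn n))) invE modn_dvdm // dvdn_exp2l.
  rewrite -[inv n.+1]muln1 -modnMmr -(invE n) modnMmr mulnA -modnMml e modnMml mul1n //.
apply/unitrP; exists (padic_reduce p_pr invP).
have e : padic_reduce p_pr invP * x = 1.
  by apply: padic_intP => n; rewrite padic_resM /= modnMml mulnC invE.
by split=> //; rewrite mulrC.
Qed.

(** Newton iteration: replacing v by v(1 + p^(m+1) t) with t = e / (v^d d0) improves y - v^d by one
    power of p and keeps v modulo p^(m+1), so the approximations converge. *)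
Theorem padic_root (d0 tau : nat) (y w : Zp) : (2 < p)%N -> ~~ (p %| d0)%N ->
  w \is a GRing.unit -> pdvd tau.+1 (y - w ^+ (d0 * p ^ tau)) ->
  exists v, y = v ^+ (d0 * p ^ tau).
Proof.
move=> p2 pd0 wU wy; set d := (d0 * p ^ tau)%N in wy *.
pose P m (v : Zp) := v \is a GRing.unit /\ pdvd (m.+1 + tau) (y - v ^+ d).
have d0U : (d0%:R : Zp) \is a GRing.unit.
  by rewrite padic_unitE padic_res_nat expn1 -/(dvdn _ _).
have step m v : P m v -> exists v', P m.+1 v' /\ pdvd m.+1 (v' - v).
  move=> [vU [e eE]].
  pose t := e / (v ^+ d * d0%:R).
  have tE : v ^+ d * (d0%:R * t) = e.
    by rewrite /t mulrA mulrC divrK // unitrM unitrX // d0U.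
  have [s sE] := expr1D_root t tau d0 p_pr p2 (ltn0Sn m); rewrite -/d in sE.
  exists (v * (1 + p%:R ^+ m.+1 * t)); split; last first.
    by exists (v * t); ring.
  split.
    rewrite unitrM vU /= padic_unitE padic_resD padic_res1 modnDml.
    rewrite (_ : (p%:R ^+ m.+1 * t) 1 = 0%N); first by rewrite modn_small // expn1 prime_gt1.
    by apply/pdvdP; exists (p%:R ^+ m * t); rewrite exprS; ring.
  exists (- (v ^+ d * s)); rewrite exprMn sE -(subrK (v ^+ d) y) eE -tE.
  by rewrite !addSn; ring.
pose nxt m v := if pselect (exists v', P m.+1 v' /\ pdvd m.+1 (v' - v)) is left e
  then projT1 (cid e) else v.
pose ws := nat_rect (fun=> Zp) w nxt.
have wsP m : P m (ws m).
  elim: m => [|m IHm]; first by split=> //; rewrite add1n.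
  rewrite /= /nxt; case: pselect => [e|]; last by move/(_ (step _ _ IHm)).
  by case: (cid e) => ? [].
have wsS m : ws m.+1 m = ws m m.
  rewrite /= /nxt; case: pselect => [e|]; last by move/(_ (step _ _ (wsP m))).
  case: (cid e) => v' /= [_ /pdvd_sub vv].
  by rewrite -(modn_padic_res v' (leqnSn m)) vv modn_padic_res.
have LP n : (ws n.+1 n.+1 = ws n n %[mod p ^ n])%N.
  by rewrite padic_resS wsS modn_padic_id.
exists (padic_reduce p_pr LP); apply: padic_intP => n.
rewrite padic_resX /= modnXm -padic_resX; apply/pdvd_sub.
have [_ [z ->]] := wsP n; exists (p%:R ^+ tau.+1 * z).
by rewrite addSn -addnS exprD; ring.
Qed.

End Padic.

(** * Descent for integral forms *)

(* Swap argument on a permutation with as many unrelated pairs as possible. *)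
Lemma perm_avoiding (I : finType) (e : rel I) : equivalence_rel e ->
  (forall i, (#|[set j | e i j]|.*2 <= #|I|)%N) ->
  exists s : {perm I}, forall i, ~~ e i (s i).
Proof.
move=> /equivalence_relP[er et] half.
have es i j : e i j = e j i by apply/idP/idP => h; rewrite -(et _ _ h) er.
pose good (s : {perm I}) := [set i | ~~ e i (s i)].
pose s := [arg max_(s > (1%g : {perm I})) #|good s|].
have smax t : (#|good t| <= #|good s|)%N by rewrite /s; case: arg_maxnP => // ? _; apply.
exists s => i; apply/negP=> ei.
(* Otherwise the class of [i] and its preimage under [s] cover [I]. Each has at most half of the
   elements, so they would be disjoint, yet both contain [i]. *)
have [j /andP[ij isj]] : exists j, ~~ e i j && ~~ e i (s j).
  have [j jP|no] := pickP [pred j | ~~ e i j && ~~ e i (s j)]; first by exists j.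
  have cU : #|[set j | e i j] :|: [set j | e i (s j)]| = #|I|.
    rewrite -cardsT; congr #|pred_of_set _|; apply/setP=> j; rewrite !inE.
    by have := no j; rewrite /= -negb_or => /negbFE.
  have cs : #|[set j | e i (s j)]| = #|[set j | e i j]|.
    rewrite (_ : [set j | e i (s j)] = s @^-1: [set j | e i j]); last by apply/setP=> j; rewrite !inE.
    exact: card_preimset perm_inj.
  have := half i; rewrite -addnn -{2}cs -cardsUI cU -[X in (_ <= X)%N]addn0 leq_add2l leqn0 cards_eq0.
  by move/eqP/setP/(_ i); rewrite !inE er ei.
have ij' : i != j by apply: contraNneq ij => <-; rewrite er.
(* Exchanging the images of [i] and [j] makes [i] good and spoils no good index: [s i] is in the
   class of [i], and [j] is not. *)
have := smax (tperm i j * s)%g; rewrite leqNgt => /negP; apply; apply: proper_card.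
apply/properP; split; last first.
  exists i; rewrite !inE ?negbK // permM tpermL //.
apply/subsetP=> k; rewrite !inE permM; case: tpermP => [->|->|_ _] //.
by move=> _; rewrite es -(et _ _ ei) // es.
Qed.

Section Core.
Variables (p : nat) (p_pr : prime p) (d : nat) (d_gt0 : (0 < d)%N).
Local Notation Zp := (padic_int p_pr).
Local Notation E := (powder p d).
Local Notation tau := (logn p d).

Section Forms.
Variable I : finType.
Implicit Types (a b : I -> Zp).

Definition solvable a b := exists x : I -> Zp, [/\ exists i, x i != 0,
  \sum_i a i * x i ^+ d = 0 & \sum_i b i * x i ^+ d = 0].

Definition det a b i j := a i * b j - a j * b i.

Lemma solvable_sym a b : solvable a b -> solvable b a.
Proof. by case=> x [? ? ?]; exists x. Qed.

Lemma solvable_scale a b a' b' (k m : Zp) (u : I -> Zp) : k != 0 -> m != 0 ->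
  (forall i, u i != 0) ->
  (forall i, k * a' i = u i ^+ d * a i) -> (forall i, m * b' i = u i ^+ d * b i) ->
  solvable a' b' -> solvable a b.
Proof.
move=> k0 m0 u0 aE bE [x [[i xi] sa sb]]; exists (fun i => u i * x i); split.
- by exists i; rewrite mulf_neq0.
- transitivity (k * (\sum_i a' i * x i ^+ d)); last by rewrite sa mulr0.
  by rewrite big_distrr; apply: eq_bigr => j _; rewrite /= mulrA aE exprMn mulrCA mulrA.
- transitivity (m * (\sum_i b' i * x i ^+ d)); last by rewrite sb mulr0.
  by rewrite big_distrr; apply: eq_bigr => j _; rewrite /= mulrA bE exprMn mulrCA mulrA.
Qed.

Hypothesis p_gt2 : (2 < p)%N.
Hypothesis I_large : forall N, (#|I| <= N * d)%N -> (d * (2 * p.-1 + 8) <= N * p.-1)%N.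

Lemma powder_gcd : (E * gcdn d p.-1)%N = p.-1.
Proof. by rewrite divnK // dvdn_gcdr. Qed.

Lemma degree_ge : (gcdn d p.-1 * p ^ tau <= d)%N.
Proof.
have g0 : (0 < gcdn d p.-1)%N by rewrite gcdn_gt0 d_gt0.
rewrite dvdn_leq // Gauss_dvd; first by rewrite dvdn_gcdl pfactor_dvdnn.
apply: coprimeXr; rewrite coprime_sym prime_coprime //; apply/negP=> pg.
have p1 : (0 < p.-1)%N by rewrite -subn1 subn_gt0 prime_gt1.
have := dvdn_leq p1 (dvdn_trans pg (dvdn_gcdr _ _)).
by rewrite leqNgt ltn_predL prime_gt0.
Qed.

(** Since p.-1 = E g and d >= g p^tau with g = gcd(d, p-1), the hypothesis [I_large] yields N E >=
    p^tau (2p + 6). *)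
Lemma large_N N : (#|I| <= N * d)%N -> ((p ^ tau.+1).*2 + 6 * p ^ tau <= N * E + 7)%N.
Proof.
move=> /I_large; have := degree_ge; have g0 : (0 < gcdn d p.-1)%N by rewrite gcdn_gt0 d_gt0.
rewrite -{3}powder_gcd expnS; move: (gcdn d p.-1) g0 (p ^ tau)%N E (prime_gt0 p_pr) => g g0 Q e p0 gQ H.
have : (g * Q * (2 * p.-1 + 8) <= N * (e * g))%N by apply: leq_trans H; rewrite leq_mul2r gQ orbT.
rewrite [(N * _)%N]mulnA [(N * e * g)%N]mulnC -mulnA leq_pmul2l //.
case: p p0 => // p' _ /=; nia.
Qed.

Lemma large_n n : (#|I| <= (n * d).*2)%N -> (p ^ tau.+1 + p ^ tau <= (n * E).+1)%N.
Proof.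
rewrite doubleMl => /I_large; have := degree_ge; have g0 : (0 < gcdn d p.-1)%N by rewrite gcdn_gt0 d_gt0.
rewrite -{3}powder_gcd expnS; move: (gcdn d p.-1) g0 (p ^ tau)%N E (prime_gt0 p_pr) => g g0 Q e p0 gQ H.
have : (g * Q * (2 * p.-1 + 8) <= n.*2 * (e * g))%N by apply: leq_trans H; rewrite leq_mul2r gQ orbT.
rewrite [(n.*2 * _)%N]mulnA [(n.*2 * e * g)%N]mulnC -mulnA leq_pmul2l //.
case: p p0 => // p' _ /=; nia.
Qed.

Lemma padic_dvdn x n : (p %| (x : Zp) n.+1)%N = (x 1 == 0%N).
Proof. by rewrite /dvdn -[p in (_ %% p)%N]expn1 modn_padic_res. Qed.

Lemma padic_res_mod (x : Zp) n : (x n.+1 = x 1 %[mod p])%N.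
Proof. by rewrite -[in RHS](@modn_padic_res _ _ x 1 n.+1) // expn1 modn_mod. Qed.

Definition level0 a b := [set i | ~~ ((a i 1 == 0%N) && (b i 1 == 0%N))].

Lemma level0_unit a b l : l \in level0 a b ->
  (a l \is a GRing.unit) || (b l \is a GRing.unit).
Proof. by rewrite inE !padic_unitE negb_and. Qed.

Definition off_line a b l := [set j | det a b l j 1 != 0%N].

Lemma detF_det a b i j :
  (detF p (fun i => a i tau.+1) (fun i => b i tau.+1) i j == 0) = (det a b i j 1 == 0%N).
Proof.
rewrite /detF /det subr_eq0 -!natrM; apply/eqP/eqP => [e|].
  apply/pdvdP/pdvd_sub; rewrite !padic_resM expn1.
  have := congr1 (fun x : 'F_p => x : nat) e; rewrite !(val_Fp_nat p_pr) => /= e'.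
  by rewrite -modnMm -!(padic_res_mod _ tau) modnMm e' -modnMm !padic_res_mod modnMm.
move/pdvdP/pdvd_sub; rewrite !padic_resM expn1 => e.
rewrite -(Fp_nat_mod p_pr) -[in RHS](Fp_nat_mod p_pr); congr (_%:R).
by rewrite -modnMm !padic_res_mod modnMm e -modnMm -!(padic_res_mod _ tau) modnMm.
Qed.

(** A nonsingular solution modulo p^(tau+1) leaves errors p^(tau+1) (za, zb). Since the determinant
    D of two active columns is a unit, changing only these two d-th powers cancels the errors, and
    [padic_root] shows that the new values are still d-th powers. *)
Lemma solvable_direct a b : (#|I| <= #|level0 a b| * d)%N ->
  (forall l, l \in level0 a b -> (#|I| <= (#|off_line a b l| * d).*2)%N) ->
  solvable a b.
Proof.
set J := level0 a b => lJ lO.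
pose A i := a i tau.+1; pose B i := b i tau.+1.
have JP : {in J, forall i, ~~ ((p %| A i) && (p %| B i))%N}.
  by move=> i; rewrite inE /A /B !padic_dvdn.
have OP l : l \in J -> [set j in J | detF p A B l j != 0] = off_line a b l.
  move=> lJ'; apply/setP=> j; rewrite !inE detF_det andb_idl //.
  apply: contraNN => /andP[/eqP aj /eqP bj]; apply/eqP/pdvdP/pdvd_sub.
  by rewrite !padic_resM aj bj muln0 mul0n.
have [|x [/andP[sa sb] [i [j [iJ jJ xi xj dij]]]]] :=
    nonsingular_solution p_pr d_gt0 JP (large_N lJ).
  by move=> l lJ'; rewrite OP //; apply: large_n; apply: lO.
pose X k : Zp := if k \in J then (x k : nat)%:R else 0.
pose D := det a b i j.
have DU : D \is a GRing.unit by rewrite padic_unitE -detF_det.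
have XU k : k \in J -> x k != 0 -> X k \is a GRing.unit.
  move=> kJ xk; rewrite padic_unitE /X kJ padic_res_nat expn1.
  apply: contraNneq xk => e; apply/eqP; rewrite -[x k]natr_Zp -(Fp_nat_mod p_pr) e //.
have ij : i != j by apply: contraNneq dij => ->; rewrite /detF subrr.
have R0 (c : I -> Zp) : (p ^ tau.+1 %| powsum d (fun i => c i tau.+1) J x)%N ->
    pdvd tau.+1 (\sum_k c k * X k ^+ d).
  move=> /eqP e; apply/pdvdP; rewrite padic_res_sum -[RHS]e /powsum [in RHS]big_mkcond.
  rewrite -[LHS]modn_summ -[RHS]modn_summ; congr (_ %% _)%N; apply: eq_bigr => k _.
  rewrite modn_padic_id padic_resM padic_resX /X; case: ifP => kJ.
    by rewrite padic_res_nat modnXm modnMmr.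
  by rewrite padic_res0 exp0n // mod0n muln0 mod0n.
have [za zaE] := R0 a sa; have [zb zbE] := R0 b sb.
set RA := \sum_k _ in zaE; set RB := \sum_k _ in zbE.
have [d0 pd0 dE] := pfactor_coprime p_pr d_gt0; rewrite prime_coprime // in pd0.
have root (k : I) (e : Zp) : k \in J -> x k != 0 ->
    exists v, v != 0 /\ v ^+ d = X k ^+ d + p%:R ^+ tau.+1 * e.
  move=> kJ xk; have XkU := XU k kJ xk.
  have [|v vE] := @padic_root p p_pr d0 tau (X k ^+ d + p%:R ^+ tau.+1 * e) (X k) p_gt2 pd0 XkU.
    by rewrite -dE; exists e; rewrite addrAC subrr add0r.
  rewrite -dE in vE; exists v; split=> //; apply/eqP=> v0.
  have : (X k ^+ d) 1 = 0%N.
    apply/pdvdP; exists (- (p%:R ^+ tau * e)); apply/eqP; rewrite mulrN mulrA -exprS.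
    by rewrite -addr_eq0 vE v0 expr0n eqn0Ngt d_gt0.
  by apply/eqP; rewrite -padic_unitE unitrX.
(* The corrections are the Cramer solution of a 2 by 2 linear system with determinant D. *)
have [v [v0 vE]] := root i ((zb * a j - za * b j) / D) iJ xi.
have [w [w0 wE]] := root j ((za * b i - zb * a i) / D) jJ xj.
pose Z k := if k == i then v else if k == j then w else X k.
have Zsum (c : I -> Zp) : \sum_k c k * Z k ^+ d = \sum_k c k * X k ^+ d +
    c i * (p%:R ^+ tau.+1 * ((zb * a j - za * b j) / D)) +
    c j * (p%:R ^+ tau.+1 * ((za * b i - zb * a i) / D)).
  have ji : j != i by rewrite eq_sym.
  rewrite (bigD1 i) // (bigD1 j) //= [in RHS](bigD1 i) // [in RHS](bigD1 j) //=.
  rewrite /Z eqxx (negbTE ji) eqxx vE wE.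
  rewrite (eq_bigr (fun k => c k * X k ^+ d)); last first.
    by move=> k /andP[/negbTE-> /negbTE->].
  by move: (p%:R ^+ _) (_ / D) (_ / D) (\sum_(k | _) _) (X i ^+ d) (X j ^+ d) => *; ring.
exists Z; split; first by exists i; rewrite /Z eqxx.
- rewrite Zsum -/RA zaE; transitivity (p%:R ^+ tau.+1 * za * (1 - D * D^-1)).
    by move: (D^-1) (p%:R ^+ _); rewrite /D /det => x1 x2; ring.
  by rewrite divrr // subrr mulr0.
rewrite Zsum -/RB zbE; transitivity (p%:R ^+ tau.+1 * zb * (1 - D * D^-1)).
  by move: (D^-1) (p%:R ^+ _); rewrite /D /det => x1 x2; ring.
by rewrite divrr // subrr mulr0.
Qed.

Variable sg : {perm I}.
Definition disc a b := \prod_i det a b i (sg i).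

Lemma prod_weights (T : {set I}) :
  \prod_i ((if i \in T then p%:R else 1 : Zp) ^+ d * (if sg i \in T then p%:R else 1) ^+ d) =
  p%:R ^+ (#|T| * d).*2.
Proof.
have T1 : \prod_i (if i \in T then p%:R else 1 : Zp) ^+ d = p%:R ^+ (#|T| * d).
  by rewrite prodrXl -big_mkcond prodr_const exprM.
rewrite big_split /= T1 -addnn exprD -[X in _ = _ * X]T1; congr (_ * _).
by symmetry; rewrite (reindex_inj (@perm_inj _ sg)).
Qed.

Lemma padic_p_neq0 : (p%:R : Zp) != 0.
Proof.
apply/eqP=> /(congr1 (fun x : Zp => x 2)); rewrite padic_res_nat padic_res0 modn_small.
  by move=> p0; move: p_gt2; rewrite p0.
by rewrite -[X in (X < _)%N]expn1 ltn_exp2l ?prime_gt1.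
Qed.

Lemma pdvd_descend (x y u : Zp) m k n : (m < k)%N -> p%:R ^+ k * y = p%:R ^+ m * (u * x) ->
  u \is a GRing.unit -> pdvd n y -> pdvd n.+1 x.
Proof.
move=> mk e uU [z yE]; move: e; rewrite {}yE -(subnKC mk); move: (k - m.+1)%N => l.
rewrite exprD exprS => e; exists (u^-1 * p%:R ^+ l * z).
apply: (mulrI uU); apply: (mulfI (expf_neq0 m padic_p_neq0)); rewrite -e exprS.
transitivity ((u * u^-1) * (p%:R * p%:R ^+ m * p%:R ^+ l * (p%:R ^+ n * z))).
  by rewrite divrr // mul1r.
by move: (u^-1) => u'; ring.
Qed.

(* Too few primitive vectors: multiply them by [p ^ d] and divide everything by [p]. *)
Lemma descend_level a b : (#|level0 a b| * d < #|I|)%N -> exists a' b',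
  (solvable a' b' -> solvable a b) /\ forall n, pdvd n (disc a' b') -> pdvd n.+1 (disc a b).
Proof.
set J := level0 a b => Jd; pose u i : Zp := if i \in J then p%:R else 1.
have p0 := padic_p_neq0.
have u0 i : u i != 0 by rewrite /u; case: ifP; rewrite ?oner_eq0.
have H (c : I -> Zp) : (forall i, i \notin J -> c i 1 = 0%N) ->
    exists c' : I -> Zp, forall i, p%:R * c' i = u i ^+ d * c i.
  move=> cJ; have /choice[c' c'E] : forall i, exists y : Zp, p%:R * y = u i ^+ d * c i.
    move=> i; rewrite /u; case: ifPn => iJ.
      by exists (p%:R ^+ d.-1 * c i); rewrite mulrA -exprS prednK.
    by have /pdvdP[y ->] := cJ i iJ; exists y; rewrite expr1n mul1r expr1.
  by exists c'.
have [|a' aE] := H a; first by move=> i; rewrite inE negbK => /andP[/eqP].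
have [|b' bE] := H b; first by move=> i; rewrite inE negbK => /andP[_ /eqP].
exists a', b'; split; first exact: (solvable_scale p0 p0 u0 aE bE).
(* Both rows are divided by p, so p^(2|I|) disc' = p^(2d|J|) disc, and d|J| < |I|. *)
move=> n; apply: (@pdvd_descend _ _ 1 (#|J| * d).*2 #|I|.*2); rewrite ?unitr1 ?ltn_double //.
have -> : p%:R ^+ #|I|.*2 = \prod_(i : I) (p%:R * p%:R) :> Zp.
  by rewrite prodr_const -expr2 -exprM mul2n.
rewrite mul1r -prod_weights /disc -!big_split /=; apply: eq_bigr => i _; rewrite -/(u i) -/(u (sg i)).
rewrite /det; transitivity ((p%:R * a' i) * (p%:R * b' (sg i)) - (p%:R * a' (sg i)) * (p%:R * b' i)).
  by ring.
by rewrite !aE !bE; ring.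
Qed.

(* Too few vectors off the line of a primitive vector [(a l, b l)]: multiply
   them by [p ^ d] and divide the coordinate vanishing on the line by [p]. *)
Lemma descend_line a b l : a l \is a GRing.unit ->
  ((#|off_line a b l| * d).*2 < #|I|)%N -> exists a' b',
  (solvable a' b' -> solvable a b) /\ forall n, pdvd n (disc a' b') -> pdvd n.+1 (disc a b).
Proof.
set J := off_line a b l => alU Jd; pose u i : Zp := if i \in J then p%:R else 1.
have p0 := padic_p_neq0.
have u0 i : u i != 0 by rewrite /u; case: ifP; rewrite ?oner_eq0.
have /choice[b' bE] : forall i, exists y : Zp, p%:R * y = u i ^+ d * det a b l i.
  move=> i; rewrite /u; case: ifPn => iJ.
    by exists (p%:R ^+ d.-1 * det a b l i); rewrite mulrA -exprS prednK.
  have : det a b l i 1 = 0%N by move: iJ; rewrite inE negbK => /eqP.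
  by move/pdvdP=> [y ->]; exists y; rewrite expr1n mul1r expr1.
exists (fun i => u i ^+ d * a i), b'; split.
  (* The second form is recovered from a_l b_i = det(l,i) + b_l a_i, with a_l a unit. *)
  move=> sab; have : solvable a (det a b l).
    by apply: (solvable_scale (oner_neq0 _) p0 u0 _ bE sab) => i; rewrite mul1r.
  case=> x [x0 sa sb]; exists x; split=> //; apply: (mulrI alU); rewrite mulr0.
  transitivity (\sum_i det a b l i * x i ^+ d + b l * \sum_i a i * x i ^+ d).
    by rewrite !big_distrr -big_split /=; apply: eq_bigr => i _; rewrite /det; ring.
  by rewrite sa sb mulr0 addr0.
(* Only one row is divided by p here: p^|I| disc' = p^(2d|J|) a_l^|I| disc, with 2d|J| < |I|. *)
move=> n; apply: (@pdvd_descend _ _ (a l ^+ #|I|) (#|J| * d).*2 #|I|); rewrite ?unitrX //.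
have -> : p%:R ^+ #|I| = \prod_(i : I) p%:R :> Zp by rewrite prodr_const.
have -> : a l ^+ #|I| = \prod_(i : I) a l by rewrite prodr_const.
rewrite -prod_weights /disc -!big_split /=; apply: eq_bigr => i _; rewrite -/(u i) -/(u (sg i)).
rewrite {1}/det; transitivity (u i ^+ d * a i * (p%:R * b' (sg i)) - u (sg i) ^+ d * a (sg i) * (p%:R * b' i)).
  by ring.
by rewrite !bE /det; ring.
Qed.

Lemma disc_sym a b : disc b a = (-1) ^+ #|I| * disc a b.
Proof.
rewrite /disc -prodr_const -big_split; apply: eq_bigr => i _; rewrite /det /=; ring.
Qed.

Lemma off_line_sym a b l : off_line b a l = off_line a b l.
Proof.
apply/setP=> j; rewrite !inE -!padic_unitE (_ : det b a l j = - det a b l j) ?unitrN //.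
by rewrite /det; ring.
Qed.

(** Induction on a power of p not dividing the discriminant: each descent lowers it by one, and when
    no descent applies [solvable_direct] does. *)
Lemma solvable_semistable a b : disc a b != 0 -> solvable a b.
Proof.
move=> /padic_neq0[n dn].
have {dn} : ~ pdvd n (disc a b) by move/pdvdP/eqP; apply/negP.
elim: n a b => [a b []|n IHn a b dn]; first by apply/pdvdP; have := padic_res_lt (disc a b) 0; rewrite expn0 ltnS leqn0 => /eqP.
have [lJ|Jl] := leqP #|I| (#|level0 a b| * d); last first.
  have [a' [b' [sol dsc]]] := descend_level Jl.
  by apply: sol; apply: IHn => /dsc.
have [l /andP[lJ' lt]|no] := pickP [pred l | (l \in level0 a b) && ((#|off_line a b l| * d).*2 < #|I|)%N]; last first.
  by apply: solvable_direct => // l lJ'; have := no l; rewrite /= lJ' ltnNge => /negbFE.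
case/orP: (level0_unit lJ') => [alU|blU].
  have [a' [b' [sol dsc]]] := descend_line alU lt.
  by apply: sol; apply: IHn => /dsc.
(* Exchanging the two forms changes the discriminant only by a sign. *)
rewrite -off_line_sym in lt.
have [a' [b' [sol dsc]]] := descend_line blU lt.
apply: solvable_sym; apply: sol; apply: IHn => /dsc [z zE]; apply: dn.
by exists ((-1) ^+ #|I| * z); rewrite mulrCA -zE [disc b a]disc_sym mulrA -exprMn mulrNN mulr1 expr1n mul1r.
Qed.

End Forms.
End Core.

(** * Forms over Q_p *)

Lemma fraction_repr (D : idomainType) (x : {fraction D}) :
  exists n m : D, m != 0 /\ x * tofrac m = tofrac n.
Proof.
elim/quotW: x => x; exists \n_x, \d_x; split; first exact: denom_ratioP.
rewrite !piE; apply/eqmodP => /=.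
rewrite FracField.equivfE /FracField.mulf !numden_Ratio ?mulf_neq0 ?oner_eq0 ?denom_ratioP //.
by rewrite !mulr1 mulrC.
Qed.

(** * Integral forms with possibly vanishing discriminant *)

Section Integral.
Variables (p : nat) (p_pr : prime p) (d : nat) (d_gt0 : (0 < d)%N).
Local Notation Zp := (padic_int p_pr).
Hypothesis p_gt2 : (2 < p)%N.

Section Line.
Variable I : finType.
Hypothesis I_large : forall N, (#|I| <= N * d)%N -> (d * (2 * p.-1 + 8) <= N * p.-1)%N.
Implicit Types a b : I -> Zp.

(* More than half of the vectors lie on a line: a single form in the
   variables of that line is solved by pairing it with a copy of itself. *)
Lemma solvable_line a b l : (forall i, (a i != 0) || (b i != 0)) -> a l != 0 ->
  (#|I| < #|[set j | (det a b l j == 0)%R]|.*2)%N -> solvable d a b.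
Proof.
set T := [set j | _] => nz al lT.
have lT' : l \in T by rewrite inE /det subrr.
have TE j : j \in T -> a l * b j = a j * b l by rewrite inE subr_eq0 => /eqP.
have aT j : j \in T -> a j != 0.
  move=> jT; apply/eqP=> aj; have := nz j; rewrite aj eqxx /= => bj.
  by move/eqP: (TE j jT); rewrite aj mul0r mulf_eq0 (negbTE al) (negbTE bj).
(* Every variable of the line occurs twice, one copy in each form. Swapping the copies is a
   permutation with nonzero determinants, and a nontrivial solution is nontrivial in at least one
   copy. *)
pose K := ('I_#|T| * bool)%type.
pose sw (k : K) : K := (k.1, ~~ k.2).
have sw_inj : injective sw by move=> [k [] ] [k' []] // [->].
pose a' (k : K) : Zp := if k.2 then a (enum_val k.1) else 0.
pose b' (k : K) : Zp := if k.2 then 0 else a (enum_val k.1).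
(* As 2|T| > |I|, the doubled system inherits the bound. *)
have K_large N : (#|{: K}| <= N * d)%N -> (d * (2 * p.-1 + 8) <= N * p.-1)%N.
  rewrite card_prod card_ord card_bool muln2 => KN; apply: I_large.
  by apply: leq_trans KN; apply: ltnW.
have dK : disc (perm sw_inj) a' b' != 0.
  apply/prodf_neq0 => -[k t] _; have ak := aT _ (enum_valP k).
  rewrite permE /det /a' /b' /sw /=; case: t => /=; rewrite ?mul0r ?mulr0 ?subr0 ?sub0r ?oppr_eq0 mulf_neq0 //.
have [x [[[k t] xk] sa sb]] := solvable_semistable d_gt0 p_gt2 K_large dK.
have sumK (c : K -> Zp) : \sum_q c q * x q ^+ d =
    \sum_k (c (k, true) * x (k, true) ^+ d + c (k, false) * x (k, false) ^+ d).
  transitivity (\sum_(q : K) (fun k t => c (k, t) * x (k, t) ^+ d) q.1 q.2).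
    by apply: eq_bigr; case.
  rewrite -(pair_bigA _ (fun k t => c (k, t) * x (k, t) ^+ d)) /=.
  by apply: eq_bigr => i _; rewrite big_bool.
rewrite !sumK in sa sb.
have st : \sum_k a (enum_val k) * x (k, t) ^+ d = 0.
  case: t xk => _; [rewrite -[RHS]sa|rewrite -[RHS]sb]; apply: eq_bigr => i _.
    by rewrite /a' /= mul0r addr0.
  by rewrite /b' /= mul0r add0r.
pose y i := if i \in T then x (enum_rank_in lT' i, t) else 0.
have ya : \sum_i a i * y i ^+ d = 0.
  rewrite -[RHS]st (bigID (mem T)) /= [X in _ + X]big1 ?addr0; last first.
    by move=> i /negbTE iT; rewrite /y iT expr0n eqn0Ngt d_gt0 mulr0.
  by rewrite big_enum_val; apply: eq_bigr => i _; rewrite /y enum_valP enum_valK_in.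
exists y; split=> //.
  by exists (enum_val k); rewrite /y enum_valP enum_valK_in.
apply: (mulfI al); rewrite mulr0; transitivity (b l * \sum_i a i * y i ^+ d); last by rewrite ya mulr0.
rewrite !big_distrr; apply: eq_bigr => i _ /=; rewrite /y; case: ifP => iT.
  by rewrite !mulrA TE // [b l * _]mulrC.
by rewrite expr0n eqn0Ngt d_gt0 !mulr0.
Qed.

Lemma solvable_integral a b : solvable d a b.
Proof.
have [i /andP[/eqP ai /eqP bi]|nz] := pickP [pred i | (a i == 0) && (b i == 0)].
  exists (fun j => (j == i)%:R); split; first by exists i; rewrite eqxx oner_eq0.
    rewrite (bigD1 i) //= ai mul0r add0r big1 // => j /negbTE->.
    by rewrite expr0n eqn0Ngt d_gt0 mulr0.
  rewrite (bigD1 i) //= bi mul0r add0r big1 // => j /negbTE->.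
  by rewrite expr0n eqn0Ngt d_gt0 mulr0.
have {}nz i : (a i != 0) || (b i != 0) by rewrite -negb_and; have /= -> := nz i.
pose e i j := det a b i j == 0.
have es i j : e i j = e j i by rewrite /e -oppr_eq0 /det opprB.
have et i j k : e i j -> e i k -> e j k.
  move=> /eqP ij /eqP ik; apply/eqP; case/orP: (nz i) => z; apply: (mulfI z); rewrite mulr0.
    transitivity (a j * det a b i k - a k * det a b i j); first by rewrite /det; ring.
    by rewrite ij ik !mulr0 subr0.
  transitivity (b j * det a b i k - b k * det a b i j); first by rewrite /det; ring.
  by rewrite ij ik !mulr0 subr0.
have eq_e : equivalence_rel e.
  move=> i j k; split; first by rewrite /e /det subrr.
  by move=> ij; apply/idP/idP; [exact: et | apply: et; rewrite es].
(* Either one proportionality class has more than half of the vectors, or [perm_avoiding] gives a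
   permutation with nonzero discriminant. *)
have [l lt|le] := pickP [pred l | #|I| < #|[set j | e l j]|.*2]%N.
  case/orP: (nz l) => z; first exact: (solvable_line nz z lt).
  apply: solvable_sym; apply: (@solvable_line _ _ l) => //; first by move=> i; rewrite orbC.
  rewrite (_ : [set j | _] = [set j | e l j]) //; apply/setP=> j; rewrite !inE /e -oppr_eq0.
  by congr (_ == 0); rewrite /det; ring.
have [sg sgP] : exists sg : {perm I}, forall i, ~~ e i (sg i).
  by apply: perm_avoiding => // i; rewrite leqNgt; have /= -> := le i.
by apply: (@solvable_semistable _ p_pr d d_gt0 I p_gt2 I_large sg); apply/prodf_neq0 => i _; apply: sgP.
Qed.
End Line.
End Integral.

(** From s <= N d follows N > (2 + eps) d, and eps (p-1) >= 8 absorbs the lower-order terms. *)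
Lemma variables_large (R : realType) (eps : R) (p d s N : nat) :
  0 < eps -> 8 <= eps * p.-1%:R -> (0 < d)%N -> (2%:R + eps) * d%:R ^+ 2 < s%:R ->
  (s <= N * d)%N -> (d * (2 * p.-1 + 8) <= N * p.-1)%N.
Proof.
move=> e0 ep d0 sd sN; rewrite -(ler_nat R) !natrM natrD natrM.
have d0' : 0 < d%:R :> R by rewrite ltr0n.
have : (2 + eps) * d%:R < N%:R.
  rewrite -(ltr_pM2r d0') -natrM -mulrA -expr2; apply: lt_le_trans sd _.
  by rewrite ler_nat.
move: (p.-1%:R : R) (N%:R : R) (d%:R : R) d0' (ler0n R p.-1) ep => q n e e0' q0 ep ne.
nra.
Qed.

Theorem theorem1p2 (R : realType) (eps : R) (eps_gt0 : 0 < eps) :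
  exists P : nat, forall (p : nat) (p_pr : prime p), (P <= p)%N ->
  forall d : nat, (0 < d)%N ->
  forall s : nat, (2%:R + eps) * d%:R ^+ 2 < s%:R ->
  forall a b : 'I_s -> padic p_pr,
  exists x : 'I_s -> padic p_pr,
    [/\ exists i, x i != 0,
        \sum_(i < s) a i * x i ^+ d = 0
      & \sum_(i < s) b i * x i ^+ d = 0].
Proof.
(* The bound on p ensures both eps (p-1) >= 8 and p > 2. *)
pose M := Num.bound (8 / eps); exists (M + 3)%N => p p_pr pM d d0 s sd a b.
have p2 : (2 < p)%N by apply: leq_trans pM; rewrite addnC.
have ep : 8 <= eps * p.-1%:R.
  rewrite mulrC -ler_pdivrMr //.
  have : 8 / eps < M%:R by apply: archi_boundP; rewrite divr_ge0 // ltW.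
  move=> /ltW /le_trans; apply; rewrite ler_nat -ltnS prednK ?prime_gt0 //.
  by apply: leq_trans pM; rewrite addn3 ltnS -addn2 leq_addr.
have I_large N : (#|'I_s| <= N * d)%N -> (d * (2 * p.-1 + 8) <= N * p.-1)%N.
  by rewrite card_ord; apply: variables_large eps_gt0 ep d0 sd.
(* Denominators m and m' of a_i and b_i are cleared by the d-th power of mm', which rescaling the
   variable x_i provides. *)
have /choice[u uE] : forall i, exists u : padic_int p_pr * (padic_int p_pr * padic_int p_pr),
    [/\ u.1 != 0, a i * tofrac u.1 ^+ d = tofrac u.2.1 & b i * tofrac u.1 ^+ d = tofrac u.2.2].
  move=> i; have [n [m [m0 aE]]] := fraction_repr (a i).
  have [n' [m' [m'0 bE]]] := fraction_repr (b i).
  exists (m * m', (n * m ^+ d.-1 * m' ^+ d, n' * m' ^+ d.-1 * m ^+ d)).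
  split=> /=; first by rewrite mulf_neq0.
    by rewrite !tofracM !tofracXn -aE exprMn -{1}(prednK d0) exprS; ring.
  by rewrite !tofracM !tofracXn -bE exprMn -{2}(prednK d0) exprS; ring.
have [x [[i xi] sa sb]] := solvable_integral d0 p2 I_large (fun i => (u i).2.1) (fun i => (u i).2.2).
exists (fun j => tofrac ((u j).1 * x j)); split.
- by exists i; rewrite tofrac_eq0 mulf_neq0 //; have [] := uE i.
- transitivity (tofrac (\sum_j (u j).2.1 * x j ^+ d)); last by rewrite sa tofrac0.
  rewrite rmorph_sum; apply: eq_bigr => j _; have [_ aE _] := uE j.
  by rewrite /= !tofracM tofracXn -aE exprMn mulrA.
transitivity (tofrac (\sum_j (u j).2.2 * x j ^+ d)); last by rewrite sb tofrac0.
rewrite rmorph_sum; apply: eq_bigr => j _; have [_ _ bE] := uE j.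
by rewrite /= !tofracM tofracXn -bE exprMn mulrA.
Qed.
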